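(* Let $q\in L_1(0,1)$ and let $N:\mathbb R\to\mathbb R$ be given by $N(u)=\sum_{i=1}^\infty a_iu^i$ for all $u\in\mathbb R$ (real coefficients $a_i$, series convergent for every real $u$). Fix $\overline N\in C^\infty(\mathbb R)$ with $\left|\frac{d^k}{du^k}N(u)\right|\le \frac{d^k}{du^k}\overline N(w)\big|_{w=|u|}$ for all $u\in\mathbb R$, $k=0,1,2,\dots$. Consider the nonlinear eigenvalue transmission problem $$u_1''+[\lambda-q(x)]u_1-N(u_1)=0,\ x\in(0,\tfrac12),\qquad u_2''+[\lambda-q(x)]u_2-N(u_2)=0,\ x\in(\tfrac12,1),$$ $$u_1(0)=u_2(1)=0,\quad u_1'(0)=1,\quad u_2(\tfrac12)-u_1(\tfrac12)=0,\quad u_2'(\tfrac12)-u_1'(\tfrac12)=1.$$ Let $(\lambda_n^{(j)},u_n^{(j)})_{j\ge0}$ be the FD-method sequence described in the context, started from the trial eigenpair $(\lambda_n^{(0)},u_n^{(0)})$, and $\overset{m}{\lambda}_n=\sum_{j=0}^m\lambda_n^{(j)}$, $\overset{m}{u}_n=\sum_{j=0}^m u_n^{(j)}$. Let $R$ be the radius of convergence of the power series $f(z)=\sum_{j\ge0}\overline v_jz^j$ defined in the context. (a) Let $\lambda_n^{(0)}=4\pi^2(\pm\frac23+2n)^2$, $n\in\{0,1,2,\dots\}$, with $u_{n1}^{(0)}(x)=\sin(\sqrt{\lambda_n^{(0)}}x)/\sqrt{\lambda_n^{(0)}}$, $u_{n2}^{(0)}(x)=\sin(\sqrt{\lambda_n^{(0)}}(1-x))/\sqrt{\lambda_n^{(0)}}$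 ($\sqrt{\lambda_n^{(0)}}>0$), and assume $r_n=\frac{2+\sqrt3}{\sqrt3\sqrt{\lambda_n^{(0)}}\,R}<1$. Then the series $\lambda_n=\sum_j\lambda_n^{(j)}$, $u_n=\sum_j u_n^{(j)}$ converge to the corresponding eigensolution $(\lambda_n,u_n)$ of the nonlinear problem, and there exist constants $c>0,\varepsilon>0$ such that, with $C=c/(1-r_n)$, for all $m\ge0$ $$\|u_n-\overset{m}{u}_n\|_\infty\le\frac{3C}{8(m+1)^{1+\varepsilon}\sqrt{\lambda_n^{(0)}}}\,r_n^{m+1},\qquad |\lambda_n-\overset{m}{\lambda}_n|\le\frac{C}{(m+1)^{1+\varepsilon}R}\,r_n^{m}.$$ (b) Let $\lambda_n^{(0)}=4\pi^2n^2$, $n\in\{1,2,\dots\}$, with $u_{n1}^{(0)}(x)=\frac{\sin(2\pi nx)}{2\pi n}$, $u_{n2}^{(0)}(x)=\frac{(-1)^n+1}{2\pi n}\sin(2\pi nx)$, and assume $r_n=\frac1{\pi nR}<1$. Then the series $\lambda_n=\sum_j\lambda_n^{(j)}$, $u_n=\sum_ju_n^{(j)}$ converge to the corresponding eigensolution $(\lambda_n,u_n)$ of the nonlinear problem, and there exist constants $c>0,\varepsilon>0$ such that, with $C=c/(1-r_n)$, for all $m\ge0$ $$|\lambda_n-\overset{m}{\lambda}_n|\le\frac{C}{(m+1)^{1+\varepsilon}R}\,r_n^m,$$ and $\|u_n-\overset{m}{u}_n\|_\infty\le\frac{3C}{8\pi n(m+1)^{1+\varepsilon}}r_n^{m+1}$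 if $n$ is even, while $\|u_n-\overset{m}{u}_n\|_\infty\le\frac{C}{8\pi n(m+1)^{1+\varepsilon}}r_n^{m+1}$ if $n$ is odd.
   Context: Notation: a function $u$ on $[0,1]$ is a pair $(u_1,u_2)$ with $u_1$ on $[0,\frac12]$, $u_2$ on $[\frac12,1]$; $\|u\|_\infty=\max\{\sup_{[0,1/2]}|u_1|,\sup_{[1/2,1]}|u_2|\}$, $\|q\|_{0,1}=\int_0^1|q|\,dx$, and $[f(\frac12)]=f_2(\frac12)-f_1(\frac12)$. Adomian polynomials: for a smooth function $G$ and functions $w_0,\dots,w_j$, $A_0(G;w_0)=G(w_0)$ and for $j\ge1$ $$A_j(G;w_0,\dots,w_j)=\sum_{\substack{\alpha_1+\dots+\alpha_j=j\\ \alpha_1\ge\dots\ge\alpha_j\ge0,\ \alpha_i\in\mathbb Z}} G^{(\alpha_1)}(w_0)\frac{w_1^{\alpha_1-\alpha_2}}{(\alpha_1-\alpha_2)!}\cdots\frac{w_{j-1}^{\alpha_{j-1}-\alpha_j}}{(\alpha_{j-1}-\alpha_j)!}\frac{w_j^{\alpha_j}}{\alpha_j!}.$$ FD-method: the trial eigenpair $(\lambda_n^{(0)},u_n^{(0)})$ is the one given in (a) or (b) (an exact solution of the linear problem with $q\equiv0$, $N\equiv0$). For $j=0,1,2,\dots$, the correction $(\lambda_n^{(j+1)},u_n^{(j+1)})$ is the (unique) real number and pair of functions such that $$u_{ni}^{(j+1)\prime\prime}+\lambda_n^{(0)}u_{ni}^{(j+1)}=F_{ni}^{(j+1)},\ i=1,2,\quad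 u_{n1}^{(j+1)}(0)=u_{n2}^{(j+1)}(1)=0,\ u_{n1}^{(j+1)\prime}(0)=0,\ [u_n^{(j+1)}(\tfrac12)]=0,\ [u_n^{(j+1)\prime}(\tfrac12)]=0,$$ with $F_{ni}^{(j+1)}=-\sum_{p=0}^j\lambda_n^{(j+1-p)}u_{ni}^{(p)}+q\,u_{ni}^{(j)}+A_j(N;u_{ni}^{(0)},\dots,u_{ni}^{(j)})$ (the value $\lambda_n^{(j+1)}$ is fixed by solvability of this overdetermined problem). Majorant series: $\overline v_0=\frac83$, $\overline v_1=(1+\overline v_0)\big(\|q\|_{0,1}\overline v_0+\overline N'(\overline v_0)\overline v_0\big)$, and for $j\ge1$ $$\overline v_{j+1}=\sum_{p=1}^j\overline v_{j+1-p}\overline v_p+(1+\overline v_0)\big(\|q\|_{0,1}\overline v_j+A_j(\overline N;\overline v_0,\dots,\overline v_j)\big);$$ $f(z)=\sum_{j\ge0}\overline v_jz^j$ (it satisfies $f-\overline v_0=(f-\overline v_0)^2+(1+\overline v_0)z[\|q\|_{0,1}f+\overline N(f)+\overline N'(\overline v_0)\overline v_0-\overline N(\overline v_0)]$), and $R>0$ is its radius of convergence. *)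

(* Defs.v *)
From HB Require Import structures.
From mathcomp Require Import all_boot all_order all_algebra.
From mathcomp Require Import all_classical all_reals all_analysis.
Set Implicit Arguments. Unset Strict Implicit. Unset Printing Implicit Defensive.
Import Order.TTheory GRing.Theory Num.Theory.
Import numFieldNormedType.Exports.
Local Open Scope classical_set_scope.
Local Open Scope ring_scope.

Section FD.
Context {R : realType}.
Local Notation leb := (@lebesgue_measure R).

Definition L1on (a b : R) (f : R -> R) : Prop :=
  leb.-integrable `[a, b]%classic (EFin \o f).

(* u solves u'' = g on [a,b] in the Caratheodory sense: du is the derivative
   of u (u(x) = u(a) + int_a^x du), du is absolutely continuous with
   du(x) = du(a) + int_a^x g, g in L1(a,b).  Boundary values of u' are du. *)
Definition ode_sol (a b : R) (g u du : R -> R) : Prop :=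
  L1on a b g /\ L1on a b du /\
  forall x, a <= x <= b ->
    u x = u a + \int[leb]_(t in `[a, x]%classic) du t /\
    du x = du a + \int[leb]_(t in `[a, x]%classic) g t.

(* alpha_{i+1} (0-based index i) of a tuple (alpha_1..alpha_j); 0 beyond j *)
Definition adom_alpha (j : nat) (al : {ffun 'I_j -> 'I_j.+1}) (i : nat) : nat :=
  if insub i is Some k then nat_of_ord (al k) else 0%N.

Definition adom_ok (j : nat) (al : {ffun 'I_j -> 'I_j.+1}) : bool :=
  ((\sum_(i < j) adom_alpha al i)%N == j) &&
  [forall i : 'I_j, (adom_alpha al i.+1 <= adom_alpha al i)%N].

(* Adomian polynomial A_j(G; w_0,...,w_j); Gd k = k-th derivative of G *)
Definition adomian (Gd : nat -> R -> R) (j : nat) (w : nat -> R) : R :=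
  \sum_(al : {ffun 'I_j -> 'I_j.+1} | adom_ok al)
    (Gd (adom_alpha al 0) (w 0%N) *
     \prod_(i < j)
       (w i.+1 ^+ (adom_alpha al i - adom_alpha al i.+1) /
        ((adom_alpha al i - adom_alpha al i.+1)`!)%:R)).

Definition majorant (qn : R) (Nbar : R -> R) (v : nat -> R) : Prop :=
  v 0%N = 8 / 3 /\
  v 1%N = (1 + v 0%N) * (qn * v 0%N + derive1n 1 Nbar (v 0%N) * v 0%N) /\
  forall j, (1 <= j)%N ->
    v j.+1 = \sum_(1 <= p < j.+1) v (j.+1 - p)%N * v p
             + (1 + v 0%N) * (qn * v j + adomian (fun k => derive1n k Nbar) j v).

Definition conv_radius (v : nat -> R) : \bar R :=
  ereal_sup [set r%:E | r in
    [set r : R | 0 <= r /\ cvg ((fun m => \sum_(j < m) `|v j| * r ^+ j) @ \oo)]].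

(* 1/R, with 1/(+oo) = 0 (only used when R > 0) *)
Definition invR (e : \bar R) : R := if e is r%:E then r^-1 else 0.

Definition FDrhs (q N : R -> R) (lam : nat -> R) (u : nat -> R -> R) (j : nat) (x : R) : R :=
  - \sum_(p < j.+1) lam (j.+1 - p)%N * u p x + q x * u j x
  + adomian (fun k => derive1n k N) j (fun p => u p x).

Definition FD_seq (q N : R -> R) (lam0 : R) (u10 u20 : R -> R)
    (lam : nat -> R) (u1 u2 du1 du2 : nat -> R -> R) : Prop :=
  lam 0%N = lam0 /\
  (forall x, 0 <= x <= 1/2 -> u1 0%N x = u10 x) /\
  (forall x, 1/2 <= x <= 1 -> u2 0%N x = u20 x) /\
  forall j : nat,
    ode_sol 0 (1/2) (fun x => FDrhs q N lam u1 j x - lam0 * u1 j.+1 x)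
            (u1 j.+1) (du1 j.+1) /\
    ode_sol (1/2) 1 (fun x => FDrhs q N lam u2 j x - lam0 * u2 j.+1 x)
            (u2 j.+1) (du2 j.+1) /\
    u1 j.+1 0 = 0 /\ u2 j.+1 1 = 0 /\ du1 j.+1 0 = 0 /\
    u2 j.+1 (1/2) = u1 j.+1 (1/2) /\ du2 j.+1 (1/2) = du1 j.+1 (1/2).

Definition eigsol (q N : R -> R) (lam : R) (u1 u2 du1 du2 : R -> R) : Prop :=
  ode_sol 0 (1/2) (fun x => (q x - lam) * u1 x + N (u1 x)) u1 du1 /\
  ode_sol (1/2) 1 (fun x => (q x - lam) * u2 x + N (u2 x)) u2 du2 /\
  u1 0 = 0 /\ u2 1 = 0 /\ du1 0 = 1 /\
  u2 (1/2) - u1 (1/2) = 0 /\ du2 (1/2) - du1 (1/2) = 1.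

Definition FD_conclusion (q N : R -> R) (rn : R)
    (lamj : nat -> R) (u1j u2j : nat -> R -> R)
    (blam bu : R -> R -> nat -> R) : Prop :=
  exists (lam : R) (u1 u2 du1 du2 : R -> R),
    eigsol q N lam u1 u2 du1 du2 /\
    (fun m => \sum_(j < m.+1) lamj j) @ \oo --> lam /\
    (forall x, 0 <= x <= 1/2 -> (fun m => \sum_(j < m.+1) u1j j x) @ \oo --> u1 x) /\
    (forall x, 1/2 <= x <= 1 -> (fun m => \sum_(j < m.+1) u2j j x) @ \oo --> u2 x) /\
    exists c eps : R, 0 < c /\ 0 < eps /\
      forall m : nat,
        let C := c / (1 - rn) in
        `|lam - \sum_(j < m.+1) lamj j| <= blam C eps m /\
        (forall x, 0 <= x <= 1/2 -> `|u1 x - \sum_(j < m.+1) u1j j x| <= bu C eps m) /\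
        (forall x, 1/2 <= x <= 1 -> `|u2 x - \sum_(j < m.+1) u2j j x| <= bu C eps m).

End FD.

(* Main.v *)
(** The correction [u_{j+1}] solves a forced oscillator equation on [0, 1] with
    zero Cauchy data at 0, so it is given by variation of constants, and its
    vanishing at 1 determines [lambda_{j+1}]. Bounding
    [\int |sin (s (x - t))| dt] by 3/4 (AM-GM) instead of 1 yields, by
    induction, [|lambda_{j+1}| <= k^j v_{j+1}] and
    [|u_{j+1}| <= kap k^{j+1} v_{j+1}] with a rate [k = (99/100)^2 K] strictly
    below the rate [K] of the statement ([rn = K / R]). This geometric slack
    absorbs the factor [(m+1)^(1+eps)], so that the singularity of [f] at [R]
    need not be analysed; it also turns truncations of Cauchy products and of
    [N (\sum u_j z^j)] into errors of size [rho^-m] with [rho > 1]. Sums of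
    Adomian polynomials are identified through
    [A_j(N; w) = [z^j] N (\sum_p w_p z^p)], first for the partial sums of the
    power series of [N], then in the limit; dominated convergence passes to
    the limit in the integrated equation. *)

Require Import Defs.
From HB Require Import structures.
From mathcomp Require Import all_boot all_order all_algebra.
From mathcomp Require Import all_classical all_reals all_analysis.
From mathcomp Require Import measurable_realfun ring lra.
Import Order.TTheory GRing.Theory Num.Theory.
Import numFieldNormedType.Exports.
Local Open Scope classical_set_scope.
Local Open Scope ring_scope.
Set Implicit Arguments.
Unset Strict Implicit.
Unset Printing Implicit Defensive.

(** * Lebesgue integrals on segments *)

(** The trial pair carries the whole jump of the derivative, so every correction is continuous at
    [1 / 2] together with its derivative; this is what permits a single problem on [[0, 1]]. The
    limit is still taken on each half, where the trial function is smooth. The factor 3/4 is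
    indispensable only for the convolution [\sum_p v_p v_(j+1-p)], whose weight in the majorant
    recursion is 1. The terms with [q] and [N] have weight [1 + v_0 = 11 / 3] and can afford both
    [|sin| <= 1], which is all that an integrable [q] allows, and a further factor 3/2. Let [kap] be
    the size of the solvability integral of the trial function and [omr] a bound for the response to
    it. The induction closes when [3 / 4 * (omr + kap) <= s * kap * k]. In (a) this asks for
    [s k >= 33 / 16], while [s K = 1 + 2 / sqrt 3 > 2.15]; in (b) for [s k >= 15 / 8], while
    [s K = 2]. The ratio 99/100 fits into these gaps. If the radius is infinite, the bounds of the
    statement are 0, so the majorant must vanish from index 1 on; this follows from
    [v_i v_j <= v_(i+j)]. *)

Section Integral.
Context {R : realType}.
Local Notation leb := (@lebesgue_measure R).
Local Notation int a b f := (\int[leb]_(t in `[a, b]%classic) f t).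
Implicit Types (a b c x y : R) (f g : R -> R).

Lemma L1on_ext a b f g : (forall x, a <= x <= b -> f x = g x) ->
  L1on a b f -> L1on a b g.
Proof.
move=> fg; apply: eq_integrable => //= x.
by rewrite inE /= in_itv /= => /fg ->.
Qed.

Lemma int_ext a b f g : (forall x, a <= x <= b -> f x = g x) ->
  int a b f = int a b g.
Proof.
by move=> fg; apply: eq_Rintegral => x; rewrite inE /= in_itv /= => /fg ->.
Qed.

Lemma L1onD a b f g : L1on a b f -> L1on a b g -> L1on a b (fun x => f x + g x).
Proof. by move=> hf hg; exact: (integrableD _ hf hg). Qed.

Lemma L1onZ a b r f : L1on a b f -> L1on a b (fun x => r * f x).
Proof. by move=> hf; exact: (integrableZl _ r hf). Qed.

Lemma L1onN a b f : L1on a b f -> L1on a b (fun x => - f x).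
Proof. by move/(L1onZ (-1)); apply: L1on_ext => x _; rewrite mulN1r. Qed.

Lemma L1onB a b f g : L1on a b f -> L1on a b g -> L1on a b (fun x => f x - g x).
Proof. by move=> hf /L1onN hg; exact: L1onD. Qed.

Lemma L1on_norm a b f : L1on a b f -> L1on a b (fun x => `|f x|).
Proof. by move=> hf; exact: integrable_norm. Qed.

Lemma L1on_sub a b c d f : a <= c -> d <= b -> L1on a b f -> L1on c d f.
Proof.
move=> ac db; apply: integrableS => //.
by move=> x /=; rewrite !in_itv /= => /andP[cx xd]; rewrite (le_trans ac) // (le_trans xd).
Qed.

Lemma L1on_within a b f : {within `[a, b]%classic, continuous f} -> L1on a b f.
Proof. by apply: continuous_compact_integrable; exact: segment_compact. Qed.

Lemma L1on_continuous a b f : continuous f -> L1on a b f.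
Proof. by move=> cf; apply: L1on_within; exact: continuous_subspaceT. Qed.

Lemma L1on_cst a b r : L1on a b (fun=> r).
Proof. by apply: L1on_continuous => x; exact: cvg_cst. Qed.

Lemma L1onM a b f g : continuous g -> L1on a b f -> L1on a b (fun x => g x * f x).
Proof.
move=> cg hf.
suff : leb.-integrable `[a, b]%classic ((EFin \o g) \* (EFin \o f))%E.
  by apply: eq_integrable.
apply: integrableMr => //.
- by apply: measurable_funTS; exact: continuous_measurable_fun.
- have /compact_bounded[M [_ mrt]] : compact (g @` `[a, b]%classic).
    apply: continuous_compact; first exact: continuous_subspaceT.
    exact: segment_compact.
  by exists M; split; rewrite ?num_real // => r Mr x abx; apply: mrt Mr _ _; exists x.
Qed.

Lemma intD a b f g : L1on a b f -> L1on a b g ->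
  int a b (fun t => f t + g t) = int a b f + int a b g.
Proof. exact: RintegralD. Qed.

Lemma intB a b f g : L1on a b f -> L1on a b g ->
  int a b (fun t => f t - g t) = int a b f - int a b g.
Proof. exact: RintegralB. Qed.

Lemma intZ a b r f : L1on a b f -> int a b (fun t => r * f t) = r * int a b f.
Proof. by move=> ?; exact: RintegralZl. Qed.

Lemma int_le a b f g : L1on a b f -> L1on a b g ->
  (forall x, a <= x <= b -> f x <= g x) -> int a b f <= int a b g.
Proof.
by move=> hf hg fg; apply: le_Rintegral => // x /=; rewrite in_itv /= => /fg.
Qed.

Lemma int_ge0 a b f : (forall x, a <= x <= b -> 0 <= f x) -> 0 <= int a b f.
Proof. by move=> f0; apply: Rintegral_ge0 => x /=; rewrite in_itv /= => /f0. Qed.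

Lemma int_norm_le a b f g : L1on a b f -> L1on a b g ->
  (forall x, a <= x <= b -> `|f x| <= g x) -> `|int a b f| <= int a b g.
Proof.
move=> hf hg fg; apply: (le_trans (le_normr_Rintegral _ hf)) => //.
by apply: int_le => //; exact: L1on_norm.
Qed.

Lemma int_point a f : int a a f = 0.
Proof. by rewrite set_itv1 Rintegral_set1. Qed.

Lemma int_split a b c f : a <= c -> c <= b -> L1on a b f ->
  int a b f = int a c f + int c b f.
Proof.
move=> ac cb hf; have /= := @Rintegral_itvB _ f (BLeft a) (BRight b) c hf.
rewrite !bnd_simp => /(_ ac cb) /eqP; rewrite subr_eq addrC => /eqP ->; congr (_ + _).
rewrite Rintegral_itv_obnd_cbnd //; apply: integrableS hf => //.
by move=> x /=; rewrite !in_itv /= => /andP[/ltW cx ->]; rewrite (le_trans ac).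
Qed.

Lemma int_cst a b r : a <= b -> int a b (fun=> r) = r * (b - a).
Proof.
move=> ab; rewrite Rintegral_cst //= lebesgue_measure_itv /= lte_fin.
by case: (ltgtP a b) ab => // -> _; rewrite subrr.
Qed.

Lemma int_FTC a b (F f : R -> R) : a <= b -> continuous f ->
  (forall x, is_derive x 1 F (f x)) -> int a b f = F b - F a.
Proof.
rewrite le_eqVlt => /predU1P[<- _ _|ab cf dF]; first by rewrite int_point subrr.
have cF : continuous F.
  by move=> x; apply: differentiable_continuous; apply/derivable1_diffP.
rewrite /Rintegral (@continuous_FTC2 _ f F) //.
- exact: continuous_subspaceT.
- split => //; first by exact/cvg_at_right_filter/cF.
  exact/cvg_at_left_filter/cF.
- by move=> x _; rewrite derive1E derive_val.
Qed.

Lemma primitive_continuous a b u du : a <= b -> L1on a b du ->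
  (forall x, a <= x <= b -> u x = u a + int a x du) ->
  {within `[a, b]%classic, continuous u}.
Proof.
move=> ab hdu hu.
apply: (@subspace_eq_continuous _ _ _ (fun x => u a + int a x du)).
  move=> x; rewrite inE /= in_itv /= => /hu uE; exact/esym.
move=> x; apply: cvgD; first exact: cvg_cst.
exact: parameterized_integral_continuous.
Qed.

(* The defect [E] of the formula satisfies
   [|E y - E x| <= 2 L (y - x) \int_x^y |dc|], so summing over a uniform
   subdivision with [n] steps shows that it is [O(1/n)]. *)
Lemma int_parts a b (phi dphi c dc : R -> R) : a <= b ->
  (forall x, is_derive x 1 phi (dphi x)) -> continuous dphi ->
  L1on a b dc -> (forall x, a <= x <= b -> c x = c a + int a x dc) ->
  phi b * c b - phi a * c a = int a b (fun t => dphi t * c t) + int a b (fun t => phi t * dc t).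
Proof.
move=> ab dphiE cdphi hdc hc.
have cphi : continuous phi.
  by move=> x; apply: differentiable_continuous; apply/derivable1_diffP.
have cc : {within `[a, b]%classic, continuous c} by exact: primitive_continuous hc.
have L1c : L1on a b c by exact: L1on_within.
have [L L0 hL] : exists2 L : R, 0 <= L & forall x, a <= x <= b -> `|dphi x| <= L.
  have /compact_bounded[M [_ mrt]] : compact (dphi @` `[a, b]%classic).
    apply: continuous_compact; first exact: continuous_subspaceT.
    exact: segment_compact.
  exists (`|M| + 1); first by rewrite addr_ge0.
  move=> x abx; apply: (mrt (`|M| + 1)); [by apply: ltr_pwDr; rewrite ?ler_norm|by exists x; rewrite //= in_itv].
have L1s x y f : a <= x -> y <= b -> L1on a b f -> L1on x y f by move=> ax yb; exact: (L1on_sub ax yb).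
have L1dc : L1on a b (fun t => phi t * dc t) by exact: L1onM.
have L1pc : L1on a b (fun t => dphi t * c t) by exact: L1onM.
have L1n := L1on_norm hdc.
have hc2 x y : a <= x -> x <= y -> y <= b -> c y - c x = int x y dc.
  move=> ax xy yb; have xb := le_trans xy yb; have ay := le_trans ax xy.
  rewrite (hc x) ?ax // (hc y) ?ay //.
  rewrite (@int_split a y x) //; last exact: (@L1s a y).
  by rewrite opprD addrACA subrr add0r addrAC subrr add0r.
pose E x y := phi y * c y - phi x * c x
   - (int x y (fun t => dphi t * c t) + int x y (fun t => phi t * dc t)).
have step x y : a <= x -> x <= y -> y <= b ->
    `|E x y| <= 2 * L * (y - x) * int x y (fun t => `|dc t|).
  move=> ax xy yb.
  have ftc : phi y - phi x = int x y dphi by rewrite (@int_FTC x y phi).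
  have hk : forall t, x <= t <= y -> `|dphi t| <= L.
    by move=> t /andP[xt ty]; apply: hL; rewrite (le_trans ax) //= (le_trans ty).
  have H0 : 0 <= int x y (fun t => `|dc t|) by apply: int_ge0.
  have L1dp : L1on x y (fun t => c x * dphi t) by apply: L1onZ; exact: L1on_continuous.
  have L1d2 : L1on x y (fun t => phi y * dc t) by apply: L1onZ; exact: L1s.
  (* Freezing [c] at the left end and [phi] at the right end is exact: [phi y c y - phi x c x = c x
     (phi y - phi x) + phi y (c y - c x)]. Only differences of nearby values remain under the
     integrals. *)
  have -> : E x y = int x y (fun t => c x * dphi t - dphi t * c t)
                  + int x y (fun t => phi y * dc t - phi t * dc t).
    rewrite /E !intB //; try exact: L1s.
    rewrite !intZ; [|exact: L1s|exact: L1on_continuous].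
    by rewrite -ftc -hc2 //; ring.
  set I := int x y (fun t => `|dc t|) in H0 *.
  have -> : 2 * L * (y - x) * I = L * I * (y - x) + L * (y - x) * I by ring.
  apply: (le_trans (ler_normD _ _)); apply: lerD.
  - rewrite -int_cst //.
    apply: int_norm_le => [||t /andP[xt ty]]; [|exact: L1on_cst|].
      by apply: L1onB => //; exact: L1s.
    rewrite mulrC -mulrBr normrM ler_pM //; first by apply: hk; rewrite xt.
    rewrite distrC hc2 //; last exact: le_trans yb.
    apply: le_trans (_ : int x t (fun t => `|dc t|) <= _).
      by apply: int_norm_le => //; apply: L1s => //; exact: le_trans yb.
    rewrite /I (@int_split x y t) //; last exact: L1s.
    by rewrite lerDl int_ge0.
  - rewrite -intZ; last exact: L1s.
    apply: int_norm_le => [||t /andP[xt ty]].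
    + by apply: L1onB => //; exact: L1s.
    + by apply: L1onZ; exact: L1s.
    rewrite -mulrBl normrM; apply: ler_wpM2r => //.
    have [z zty ->] := @MVT_segment _ phi dphi t y ty (fun x _ => dphiE x)
       (continuous_subspaceT cphi).
    rewrite normrM ler_pM //.
      by apply: hk; move: zty; rewrite in_itv /= => /andP[tz ->]; rewrite (le_trans xt).
    by rewrite ger0_norm ?subr_ge0 // lerD2l lerN2.
have Eadd x y z : a <= x -> x <= y -> y <= z -> z <= b -> E x z = E x y + E y z.
  move=> ax xy yz zb.
  have xz := le_trans xy yz.
  by rewrite /E (@int_split x z y (fun t => dphi t * c t)) // ?(@int_split x z y (fun t => phi t * dc t)) //; try (exact: L1s); ring.
suff E0 : E a b = 0.
  by move/eqP: E0; rewrite /E subr_eq0 => /eqP.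
pose V := int a b (fun t => `|dc t|).
have V0 : 0 <= V by apply: int_ge0.
have small n : `|E a b| <= 2 * L * (b - a) / n.+1%:R * V.
  pose d := (b - a) / n.+1%:R.
  have d0 : 0 <= d by rewrite divr_ge0 // subr_ge0.
  have part m : (m <= n.+1)%N ->
     `|E a (a + m%:R * d)| <= 2 * L * d * int a (a + m%:R * d) (fun t => `|dc t|).
    elim: m => [_|m IH mn].
      by rewrite mul0r addr0 /E !int_point addr0 !subrr normr0 mulr0.
    have le1 : a <= a + m%:R * d by rewrite lerDl mulr_ge0.
    have le2 : a + m%:R * d <= a + m.+1%:R * d by rewrite lerD2l ler_wpM2r // ler_nat.
    have le3 : a + m.+1%:R * d <= b.
      rewrite -lerBrDl /d mulrA mulrAC ler_piMl ?subr_ge0 //.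
      by rewrite ler_pdivrMr ?ltr0n // mul1r ler_nat.
    rewrite (@Eadd a (a + m%:R * d)) // (@int_split a (a + m.+1%:R * d) (a + m%:R * d)) //; last exact: L1s.
    rewrite mulrDr; apply: (le_trans (ler_normD _ _)); apply: lerD; first by apply: IH; exact: ltnW.
    apply: (le_trans (step _ _ le1 le2 le3)); rewrite le_eqVlt; apply/orP; left; apply/eqP.
    by congr (_ * _ * _); rewrite -natr1; ring.
  have /(_ (leqnn _)) := part n.+1.
  have -> : a + n.+1%:R * d = b by rewrite /d mulrCA divff ?pnatr_eq0 // mulr1 addrC subrK.
  by move/le_trans; apply; rewrite /d /V !mulrA.
apply/eqP; rewrite -normr_eq0 -[_ == 0]negbK; apply/negP => En0.
have E0 : 0 < `|E a b| by rewrite lt_neqAle eq_sym En0 /=.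
pose B := 2 * L * (b - a) * V.
have [n hn] : exists n : nat, B / `|E a b| < n%:R.
  by exists (Num.bound (B / `|E a b|)); apply: archi_boundP; rewrite divr_ge0 ?mulr_ge0 ?subr_ge0.
have := small n; rewrite leNgt => /negP; apply.
rewrite mulrAC ltr_pdivrMr ?ltr0n // [_ * n.+1%:R]mulrC -ltr_pdivrMr // (lt_trans hn) //.
by rewrite ltr_nat.
Qed.

End Integral.

(** * The forced oscillator in the Caratheodory sense *)

Section Oscillator.
Context {R : realType}.
Local Notation leb := (@lebesgue_measure R).
Local Notation int a b f := (\int[leb]_(t in `[a, b]%classic) f t).

Lemma is_derive_affine (al be x : R) : is_derive x 1 (fun t => al + be * t) be.
Proof.
have h := is_deriveD (is_derive_cst al x 1) (is_deriveZ be (is_derive_id x 1)).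
by apply: (is_derive_eq h); rewrite add0r /GRing.scale /= mulr1.
Qed.

Lemma is_derive_sin_affine (al be x : R) :
  is_derive x 1 (fun t => sin (al + be * t)) (be * cos (al + be * x)).
Proof.
have h := @is_derive1_comp _ sin _ x _ be (is_derive_sin _) (is_derive_affine al be x).
by apply: (is_derive_eq h); rewrite mulrC.
Qed.

Lemma is_derive_cos_affine (al be x : R) :
  is_derive x 1 (fun t => cos (al + be * t)) (- (be * sin (al + be * x))).
Proof.
have h := @is_derive1_comp _ cos _ x _ be (is_derive_cos _) (is_derive_affine al be x).
by apply: (is_derive_eq h); rewrite mulNr mulrC.
Qed.

Lemma continuous_sin_affine (al be : R) : continuous (fun t => sin (al + be * t)).
Proof.
by move=> x; apply: differentiable_continuous; apply/derivable1_diffP;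
  have := is_derive_sin_affine al be x => -[].
Qed.

Lemma continuous_cos_affine (al be : R) : continuous (fun t => cos (al + be * t)).
Proof.
by move=> x; apply: differentiable_continuous; apply/derivable1_diffP;
  have := is_derive_cos_affine al be x => -[].
Qed.

Lemma mul_sin_sin (x y : R) : sin x * sin y = (cos (x - y) - cos (x + y)) / 2.
Proof. by rewrite cosB cosD; field. Qed.

(** The phases run in opposite directions, so their sum [al + be] does not depend on [t] and only
    the cosine of the difference oscillates. With [be = - al] this gives the integral of a squared
    sine up to sign. *)
Lemma int_sin_sin (s al be c d : R) : s != 0 -> c <= d ->
  int c d (fun t => sin (al - s * t) * sin (be + s * t)) =
  ((sin (al - be - 2 * s * c) - sin (al - be - 2 * s * d)) / (2 * s)
    - cos (al + be) * (d - c)) / 2.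
Proof.
move=> s0 cd.
pose ph (t : R) : R := al - be + (- (2 * s)) * t.
have ctsin : continuous (fun t => sin (al - s * t) * sin (be + s * t)).
  move=> t; apply: (@cvgM _ _ _ _ (fun t => sin (al - s * t)) (fun t => sin (be + s * t))).
    under eq_fun => u do rewrite -mulNr.
    by rewrite -mulNr; exact: continuous_sin_affine.
  exact: continuous_sin_affine.
have Fd (x : R) : is_derive x 1
    (fun t => - (4 * s)^-1 * sin (ph t) + (0 + - (cos (al + be) / 2) * t))
    (sin (al - s * x) * sin (be + s * x)).
  have h := is_deriveD (is_deriveZ (- (4 * s)^-1) (is_derive_sin_affine (al - be) (- (2 * s)) x))
    (is_derive_affine 0 (- (cos (al + be) / 2)) x).
  apply: (is_derive_eq h); rewrite mul_sin_sin /GRing.scale /=.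
  have -> : al - be + - (2 * s) * x = al - s * x - (be + s * x) by ring.
  have -> : al - s * x + (be + s * x) = al + be by ring.
  by field.
by rewrite (int_FTC cd ctsin Fd) /ph !mulNr; field.
Qed.

(** Two integrations by parts, of [du] against [sin (s (x - t))] and of [u] against
    [cos (s (x - t))]. The sine vanishes at [t = x] and the zero Cauchy data remove the terms at 0,
    so [s * u x] is the only boundary term left. *)
Lemma variation_of_constants (s b : R) (F u du : R -> R) :
  ode_sol 0 b (fun t => F t - s ^+ 2 * u t) u du -> u 0 = 0 -> du 0 = 0 ->
  forall x, 0 <= x <= b ->
  L1on 0 x F /\ s * u x = int 0 x (fun t => sin (s * (x - t)) * F t).
Proof.
move=> [L1g [L1du hu]] u0 du0 x /andP[x0 xb].
have b0 := le_trans x0 xb.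
have cu : {within `[0, b]%classic, continuous u}.
  by apply: (@primitive_continuous _ 0 b u du) => // y /hu[].
have L1u : L1on 0 b u by exact: L1on_within.
have sub f : L1on 0 b f -> L1on 0 x f by exact: L1on_sub.
have L1F : L1on 0 b F.
  apply: (L1on_ext _ (L1onD L1g (L1onZ (s ^+ 2) L1u))) => t _ /=.
  by rewrite subrK.
split; first exact: sub.
pose S (t : R) : R := sin (s * x + (- s) * t); pose C (t : R) : R := cos (s * x + (- s) * t).
have cS : continuous S by exact: continuous_sin_affine.
have cC : continuous C by exact: continuous_cos_affine.
have cZ r (f : R -> R) : continuous f -> continuous (fun t => r * f t).
  by move=> cf t; apply: cvgMl_tmp; exact: cf.
have P1 := @int_parts _ 0 x S (fun t => (- s) * C t) du (fun t => F t - s ^+ 2 * u t) x0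
  (is_derive_sin_affine _ _) (cZ _ _ cC) (sub _ L1g).
have P2 := @int_parts _ 0 x C (fun t => - ((- s) * S t)) u du x0
  (is_derive_cos_affine _ _) (fun t => continuousN (cZ _ _ cS t)) (sub _ L1du).
have le_b t : 0 <= t <= x -> 0 <= t <= b.
  by move=> /andP[-> tx]; rewrite (le_trans tx).
have {}P1 := P1 (fun t h => (hu t (le_b t h)).2).
have {}P2 := P2 (fun t h => (hu t (le_b t h)).1).
have Sx : S x = 0 by rewrite /S mulNr subrr sin0.
have Cx : C x = 1 by rewrite /C mulNr subrr cos0.
rewrite Sx u0 du0 !Cx !(mul0r, mulr0) !subr0 in P1 P2.
have L1x (f : R -> R) : continuous f -> L1on 0 x (fun t => f t * u t) by move=> cf; apply: L1onM => //; exact: sub.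
have -> : (fun t => sin (s * (x - t)) * F t) =
   (fun t => S t * (F t - s ^+ 2 * u t) + s ^+ 2 * (S t * u t)).
  apply/funext => t; rewrite /S -/(s ^+ 2).
  by rewrite (_ : s * (x - t) = s * x + - s * t); ring.
rewrite intD; [|by apply: L1onM => //; exact: sub|by apply: L1onZ; exact: L1x].
rewrite intZ; last exact: L1x.
have E1 : int 0 x (fun t => - s * C t * du t) = - s * int 0 x (fun t => C t * du t).
  rewrite -intZ; first by apply: int_ext => t _; rewrite mulrA.
  by apply: L1onM => //; exact: sub.
have E2 : int 0 x (fun t => - (- s * S t) * u t) = s * int 0 x (fun t => S t * u t).
  by rewrite -intZ; [apply: int_ext => t _; ring|exact: L1x].
rewrite E1 in P1; rewrite E2 in P2.
rewrite mul1r in P2; rewrite P2.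
move: P1 => /esym/eqP; rewrite addrC addr_eq0 => /eqP ->; ring.
Qed.

(** The left function wins at the junction [h]. *)
Definition glue (h : R) (f1 f2 : R -> R) (x : R) : R := if x <= h then f1 x else f2 x.

(** Needed because [glue] takes the left value at [h]: on the right half it agrees with the right
    function only on the half-open interval. *)
Lemma int_ext_oc (a b : R) f g : L1on a b f -> L1on a b g ->
  (forall x, a < x <= b -> f x = g x) -> int a b f = int a b g.
Proof.
have sub : `]a, b]%classic `<=` `[a, b]%classic.
  by move=> x /=; rewrite !in_itv /= => /andP[/ltW -> ->].
have oc h : L1on a b h -> int a b h = \int[leb]_(t in `]a, b]%classic) h t.
  by move=> hL; rewrite Rintegral_itv_obnd_cbnd //; exact: integrableS hL.
move=> hf hg fg; rewrite !oc //; apply: eq_Rintegral => x.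
by rewrite inE /= in_itv /= => /fg.
Qed.

Lemma L1on_glue (a h b : R) f1 f2 : a <= h -> h <= b -> L1on a h f1 -> L1on h b f2 ->
  L1on a b (glue h f1 f2).
Proof.
move=> ah hb h1 h2.
have sub1 : leb.-integrable `[a, b]%classic ((EFin \o f1) \_ `[a, h]%classic).
  by apply: (@integrableS _ _ _ _ setT) => //; exact: (integrable_mkcond _ _).1.
have sub2 : leb.-integrable `[a, b]%classic ((EFin \o f2) \_ `]h, b]%classic).
  apply: (@integrableS _ _ _ _ setT) => //; apply: (integrable_mkcond _ _).1 => //.
  apply: integrableS h2 => //.
  by move=> x /=; rewrite !in_itv /= => /andP[/ltW -> ->].
apply: eq_integrable (integrableD _ sub1 sub2) => // x.
rewrite inE /= in_itv /= => /andP[ax xb].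
rewrite /glue /patch !mem_setE !in_itv /= ax xb andbT /=.
by case: leP => xh /=; rewrite ?add0e ?adde0.
Qed.

Lemma int_glue_right (a h b : R) f1 f2 x : a <= h -> h <= x -> x <= b ->
  L1on a h f1 -> L1on h b f2 ->
  int a x (glue h f1 f2) = int a h f1 + int h x f2.
Proof.
move=> ah hx xb h1 h2.
have h2x : L1on h x f2 by apply: L1on_sub h2.
have L := L1on_glue ah hx h1 h2x.
rewrite (int_split ah hx L); congr (_ + _).
  by apply: int_ext => t /andP[_ th]; rewrite /glue th.
apply: int_ext_oc => // [|t /andP[ht _]]; first exact: L1on_sub L.
by rewrite /glue leNgt ht.
Qed.

Lemma int_glue_left (a h : R) f1 f2 x : x <= h ->
  int a x (glue h f1 f2) = int a x f1.
Proof.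
by move=> xh; apply: int_ext => t /andP[_ tx]; rewrite /glue (le_trans tx).
Qed.

(** The integral identities continue across [h] because both [u] and [du] match there, which holds
    for the corrections but not for the trial function. *)
Lemma ode_sol_glue (a h b : R) g1 g2 u1 u2 du1 du2 : a <= h -> h <= b ->
  ode_sol a h g1 u1 du1 -> ode_sol h b g2 u2 du2 ->
  u2 h = u1 h -> du2 h = du1 h ->
  ode_sol a b (glue h g1 g2) (glue h u1 u2) (glue h du1 du2).
Proof.
move=> ah hb [L1 [D1 H1]] [L2 [D2 H2]] uh duh.
split; first exact: L1on_glue.
split; first exact: L1on_glue.
move=> x /andP[ax xb].
have ga f1 f2 : glue h f1 f2 a = f1 a by rewrite /glue ah.
rewrite !ga; have [xh|hx] := leP x h.
  by rewrite !int_glue_left // /glue xh; apply: H1; rewrite ax.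
have hx' := ltW hx.
rewrite !(int_glue_right _ _ xb) // /glue leNgt hx /=.
have [|-> ->] := H2 x; first by rewrite hx'.
have [|e1 e2] := H1 h; first by rewrite ah lexx.
by rewrite uh duh e1 e2 !addrA.
Qed.

Lemma L1on_dominated_cvg (a b : R) (f : nat -> R -> R) g h :
  (forall m, L1on a b (f m)) -> L1on a b h ->
  (forall x, a <= x <= b -> f ^~ x @ \oo --> g x) ->
  (forall m x, a <= x <= b -> `|f m x| <= h x) ->
  L1on a b g /\ (fun m => int a b (f m)) @ \oo --> int a b g.
Proof.
move=> hf hh fg fh.
have mg : measurable_fun `[a, b]%classic g.
  apply: (@measurable_fun_cvg _ _ _ _ f) => //.
  by move=> m; apply/measurable_EFinP; exact: (measurable_int _ (hf m)).
have h1 m : measurable_fun `[a, b]%classic (EFin \o f m) by exact: (measurable_int _ (hf m)).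
have h2 : measurable_fun `[a, b]%classic (EFin \o g) by exact/measurable_EFinP.
have h3 : {ae leb, forall x, `[a, b]%classic x -> (fun m => (EFin \o f m) x) @ \oo --> (EFin \o g) x}.
  apply: aeW => x /=; rewrite in_itv /= => /fg fgx.
  by apply/fine_cvgP; split; [exact: nearW|].
have h4 : {ae leb, forall x m, `[a, b]%classic x -> (`|(EFin \o f m) x| <= (EFin \o h) x)%E}.
  by apply: aeW => x m /=; rewrite in_itv /= lee_fin => /fh.
have [L1g _ C] := @dominated_convergence _ _ _ leb _ (measurable_itv _) _ _ _ h1 h2 h3 hh h4.
split => //.
have fing : (\int[leb]_(x in `[a, b]) (EFin \o g) x)%E \is a fin_num by exact: integrable_fin_num.
by move: C; rewrite -(fineK fing) => /fine_cvgP[_].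
Qed.

Lemma ode_sol_ext (a b : R) g g' u u' du du' :
  (forall x, a <= x <= b -> g x = g' x) -> (forall x, a <= x <= b -> u x = u' x) ->
  (forall x, a <= x <= b -> du x = du' x) ->
  ode_sol a b g u du -> ode_sol a b g' u' du'.
Proof.
move=> gg uu dd [L1 [D1 H]]; split; first exact: L1on_ext L1.
split; first exact: L1on_ext D1.
move=> x xab; have [ax xb] := andP xab.
have aab : a <= a <= b by rewrite lexx (le_trans ax).
have [e1 e2] := H x xab; rewrite -!uu // -!dd // e1 e2; split; congr (_ + _);
  apply: int_ext => t /andP[at_ tx]; [apply: dd|apply: gg]; rewrite at_ (le_trans tx) //.
Qed.

Lemma ode_solD (a b : R) g g' u u' du du' :
  ode_sol a b g u du -> ode_sol a b g' u' du' ->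
  ode_sol a b (fun x => g x + g' x) (fun x => u x + u' x) (fun x => du x + du' x).
Proof.
move=> [L1 [D1 H1]] [L2 [D2 H2]]; split; first exact: L1onD.
split; first exact: L1onD.
move=> x xab; have [_ xb] := andP xab.
have [-> ->] := H1 x xab; have [-> ->] := H2 x xab.
by rewrite !intD; [split; ring|exact: L1on_sub xb L1|exact: L1on_sub xb L2|
  exact: L1on_sub xb D1|exact: L1on_sub xb D2].
Qed.

Lemma ode_sol_C2 (a b : R) (u du g : R -> R) :
  (forall x : R, is_derive x 1 u (du x)) -> (forall x : R, is_derive x 1 du (g x)) ->
  continuous g -> ode_sol a b g u du.
Proof.
move=> hu hdu cg.
have cdu : continuous du.
  by move=> x; apply: differentiable_continuous; apply/derivable1_diffP.
split; first exact: L1on_continuous.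
split; first exact: L1on_continuous.
by move=> x /andP[ax _]; rewrite (int_FTC ax cdu hu) (int_FTC ax cg hdu) !subrKC.
Qed.

(** The derivatives are assumed to converge only at [a]: dominated convergence in
    [DU m x = DU m a + \int_a^x G m] gives the other points, and a second passage, with a constant
    dominating function, treats the identity for [U]. The last conclusion carries the value of the
    derivative from the left half to the right one. *)
Lemma ode_sol_limit (a b : R) (G U DU : nat -> R -> R) (g u h : R -> R) d :
  (forall m, ode_sol a b (G m) (U m) (DU m)) -> L1on a b h ->
  (forall x, a <= x <= b -> U ^~ x @ \oo --> u x) ->
  DU ^~ a @ \oo --> d ->
  (forall x, a <= x <= b -> G ^~ x @ \oo --> g x) ->
  (forall m x, a <= x <= b -> `|G m x| <= h x) ->
  ode_sol a b g u (fun x => d + int a x g) /\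
  forall x, a <= x <= b -> DU ^~ x @ \oo --> d + int a x g.
Proof.
move=> hode L1h hU hd hG Gh.
have sub f x : x <= b -> L1on a b f -> L1on a x f by move=> xb; apply: L1on_sub.
have dom x : a <= x <= b -> L1on a x g /\ (fun m => int a x (G m)) @ \oo --> int a x g.
  move=> /andP[ax xb]; apply: (@L1on_dominated_cvg _ _ _ _ h).
  - by move=> m; apply: sub xb _; exact: (hode m).1.
  - exact: sub xb L1h.
  - by move=> t /andP[at_ tx]; apply: hG; rewrite at_ (le_trans tx).
  - by move=> m t /andP[at_ tx]; apply: Gh; rewrite at_ (le_trans tx).
have [ab|ba] := leP a b; last first.
  have nab x : a <= x <= b -> False.
    by move=> /andP[ax /(le_trans ax)]; rewrite leNgt ba.
  have L1any f : L1on a b f.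
    by apply: (@L1on_ext _ _ _ (fun=> 0)); [move=> x /nab|exact: L1on_cst].
  by split=> [|x /nab //]; split => //; split => // x /nab.
have [Dbd hDbd] : exists D, forall m, `|DU m a| <= D.
  have : bounded_fun (fun m => DU m a) by apply: cvg_seq_bounded; apply/cvg_ex; exists d.
  by move=> [M [_ hM]]; exists (M + 1) => m; apply: hM => //; rewrite ltrDl.
have abx : a <= b <= b by rewrite ab lexx.
have abx0 : a <= a <= b by rewrite ab lexx.
have DUE m x : a <= x <= b -> DU m x = DU m a + int a x (G m).
  by move=> /((hode m).2.2 _)[].
have cvgDU x : a <= x <= b -> DU ^~ x @ \oo --> d + int a x g.
  move=> xab; apply: cvg_trans (cvgD hd (dom x xab).2).
  by apply: near_eq_cvg; apply: nearW => m /=; rewrite DUE.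
have dom2 x : a <= x <= b -> (fun m => int a x (DU m)) @ \oo --> int a x (fun x => d + int a x g).
  move=> /andP[ax xb]; apply: (proj2 (A := L1on a x (fun x => d + int a x g))).
  apply: (@L1on_dominated_cvg _ _ _ _ (fun=> Dbd + int a b h)).
  - by move=> m; apply: sub xb _; exact: (hode m).2.1.
  - exact: L1on_cst.
  - by move=> t /andP[at_ tx]; apply: cvgDU; rewrite at_ (le_trans tx).
  - move=> m t /andP[at_ tx]; have tb := le_trans tx xb.
    rewrite DUE ?at_ //; apply: (le_trans (ler_normD _ _)); apply: lerD => //.
    rewrite (int_split at_ tb L1h); apply: (@le_trans _ _ (int a t h)).
      apply: int_norm_le; [exact: sub tb (hode m).1|exact: sub tb L1h|].
      by move=> r /andP[ar rt]; apply: Gh; rewrite ar (le_trans rt).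
    rewrite lerDl; apply: int_ge0 => r /andP[tr rb].
    by apply: le_trans (Gh 0%N r _); rewrite ?normr_ge0 // rb (le_trans at_).
split => //; split; first exact: (dom b abx).1.
split.
  apply: L1on_within; apply: (@primitive_continuous _ a b _ g) => //; first exact: (dom b abx).1.
  by move=> x _; rewrite int_point addr0.
move=> x xab; split; last by rewrite int_point addr0.
apply: (cvg_unique _ (hU x xab)) => //.
apply: cvg_trans (cvgD (hU a abx0) (dom2 x xab)).
by apply: near_eq_cvg; apply: nearW => m; have [/esym] := (hode m).2.2 x xab.
Qed.

End Oscillator.

(** * Adomian polynomials as coefficients of a composition *)

Section Adomian.
Context {R : realType}.
Implicit Types (w : nat -> R) (Gd : nat -> R -> R).

(** The constant term is left out because [w 0] serves as the centre of a Taylor expansion; its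
    [k]-th power then starts at degree [k]. *)
Definition tailpoly w (M : nat) : {poly R} := \sum_(p < M) (w p.+1)%:P * 'X^(p.+1).

(* Truncated exponential of [w_p X^p Y]: the coefficient of [Y^k] in the product
   over [p] is [(\sum_p w_p X^p)^k / k!], which replaces the multinomial theorem. *)
Definition expfactor (w : nat -> R) (B p : nat) : {poly {poly R}} :=
  \sum_(b < B) ((w p.+1 ^+ b / b`!%:R)%:P * 'X^(p.+1 * b))%:P * 'X^b.

Lemma coef_expfactor w B p m : (m < B)%N ->
  (expfactor w B p)`_m = (m`!%:R^-1)%:P * ((w p.+1)%:P * 'X^(p.+1)) ^+ m.
Proof.
move=> mB; rewrite coef_sum (bigD1 (Ordinal mB)) //= big1 ?addr0.
  rewrite coefCM coefXn eqxx mulr1 exprMn -polyC_exp -exprM mulrA -polyCM.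
  by rewrite mulrC [_ * w _ ^+ _]mulrC mulrC.
move=> i; rewrite -val_eqE /= => im.
by rewrite coefCM coefXn eq_sym (negbTE im) mulr0.
Qed.

Lemma coef_prod_expfactor w B M k : (k < B)%N ->
  (\prod_(p < M) expfactor w B p)`_k = (k`!%:R^-1)%:P * tailpoly w M ^+ k.
Proof.
elim: M k => [|M IH] k kB.
  rewrite big_ord0 /tailpoly big_ord0 coef1 expr0n.
  by case: k kB => [|k] _ /=; rewrite ?mulr0 // fact0 invr1 mulr1.
have -> : tailpoly w M.+1 = (w M.+1)%:P * 'X^(M.+1) + tailpoly w M.
  by rewrite /tailpoly big_ord_recr addrC.
rewrite big_ord_recr /= coefM exprDn mulr_sumr; apply: eq_bigr => i _.
have ik : (i <= k)%N by rewrite -ltnS.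
rewrite IH ?(leq_ltn_trans ik) // coef_expfactor ?(leq_ltn_trans (leq_subr _ _)) //.
have e : i`!%:R^-1 * (k - i)`!%:R^-1 = k`!%:R^-1 * 'C(k, i)%:R :> R.
  rewrite -(bin_fact ik) !natrM !invfM [RHS]mulrC mulVKf //.
  by rewrite pnatr_eq0 -lt0n bin_gt0.
rewrite mulrACA -polyCM e polyCM [('C(k, i)%:R)%:P]rmorph_nat -[X in _ = _ * X]mulr_natr; ring.
Qed.

(** Choosing one term in each factor is choosing a multiplicity vector [b]; the two degrees record
    the number of parts and their weighted sum. *)
Lemma coef_prod_expfactor_expand w B M k j :
  ((\prod_(p < M) expfactor w B p)`_k)`_j =
  \sum_(b : {ffun 'I_M -> 'I_B} | (\sum_(i < M) b i == k)%N && (\sum_(i < M) i.+1 * b i == j)%N)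
     \prod_(i < M) (w i.+1 ^+ b i / (b i)`!%:R).
Proof.
rewrite bigA_distr_bigA /= coef_sum coef_sum [RHS]big_mkcond /=.
apply: eq_bigr => b _.
have -> : \prod_(i < M) (((w i.+1 ^+ b i / (b i)`!%:R)%:P * 'X^(i.+1 * b i))%:P * 'X^(b i)) =
  ((\prod_(i < M) (w i.+1 ^+ b i / (b i)`!%:R))%:P * 'X^(\sum_(i < M) i.+1 * b i)%N)%:P
   * 'X^(\sum_(i < M) b i)%N :> {poly {poly R}}.
  rewrite big_split /= -!prodrXr; congr (_ * _).
  rewrite -rmorph_prod /= big_split /= -rmorph_prod /=; congr ((_ * _)%:P).
rewrite coefCM coefXn eq_sym; case: eqP => _ /=; last by rewrite mulr0 coef0.
by rewrite mulr1 coefCM coefXn eq_sym; case: eqP => _ /=; rewrite ?mulr1 ?mulr0.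
Qed.

(** Double counting of the pairs [i <= m]. For multiplicities [b], the suffix sums are the [alpha],
    so the weight of [b] is the sum of the [alpha]. *)
Lemma sum_suffix (j : nat) (b : nat -> nat) :
  (\sum_(i < j) \sum_(i <= m < j) b m = \sum_(i < j) i.+1 * b i)%N.
Proof.
rewrite -(big_mkord xpredT (fun i => \sum_(i <= m < j) b m)%N).
rewrite -(big_mkord xpredT (fun i => i.+1 * b i)%N).
elim: j => [|j IH]; first by rewrite !big_nil.
rewrite [RHS]big_nat_recr //= -IH big_nat_recr //= big_nat1.
rewrite (eq_big_nat _ _ (F2 := fun i => \sum_(i <= m < j) b m + b j)%N); last first.
  by move=> i /andP[_ ij]; rewrite big_nat_recr // ltnW.
by rewrite big_split /= sum_nat_const_nat subn0 -addnA mulSn [(b j + _)%N]addnC.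
Qed.

(** Telescoping in [nat]: monotonicity keeps the truncated subtractions exact. *)
Lemma sum_decrements (a : nat -> nat) (j i : nat) : (i <= j)%N ->
  (forall m, (m < j)%N -> a m.+1 <= a m)%N ->
  (\sum_(i <= m < j) (a m - a m.+1) = a i - a j)%N.
Proof.
elim: j => [|j IH] ij ha.
  by move: ij; rewrite leqn0 => /eqP ->; rewrite big_nil subnn.
have [->|] := eqVneq i j.+1; first by rewrite big_geq // subnn.
rewrite neq_ltn ltnS [(j.+1 < i)%N]ltnNge ij orbF => ij'.
rewrite big_nat_recr //= IH // => [|m mj]; last by rewrite ha // ltnW.
have aj : (a j <= a i)%N.
  elim: j ij' ha {IH ij} => [|j IH]; first by rewrite leqn0 => /eqP ->.
  rewrite leq_eqVlt => /predU1P[->//|]; rewrite ltnS => ij ha.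
  apply: (leq_trans (ha j _)); first by rewrite ltnW.
  by apply: IH => // m mj; apply: ha; exact: ltnW.
by rewrite addnBA ?ha // subnK.
Qed.

(** The admissible [alpha] correspond to multiplicity vectors [b] of weight [j], with [alpha_1]
    equal to the total [\sum b]. Grouping by this total [k] collects the coefficient of [X^j] in
    [tailpoly ^ k / k!]; since each part has weight at least 1, [k <= j]. *)
Lemma adomianE Gd j w : adomian Gd j w =
  \sum_(k < j.+1) Gd k (w 0%N) * ((tailpoly w j ^+ k)`_j / k`!%:R).
Proof.
pose P (b : {ffun 'I_j -> 'I_j.+1}) := (\sum_(i < j) i.+1 * b i == j)%N.
pose c (b : {ffun 'I_j -> 'I_j.+1}) := \prod_(i < j) (w i.+1 ^+ b i / (b i)`!%:R).
have sumP b : P b -> (\sum_(i < j) b i < j.+1)%N.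
  by move=> /eqP pb; rewrite ltnS -[X in (_ <= X)%N]pb leq_sum // => i _; rewrite leq_pmull.
transitivity (\sum_(b | P b) Gd (\sum_(i < j) b i)%N (w 0%N) * c b); last first.
  transitivity (\sum_(k < j.+1) \sum_(b | P b && (\sum_(i < j) b i == k)%N) Gd k (w 0%N) * c b).
    rewrite (exchange_big_dep P) /=; last by move=> k b _ /andP[].
    apply: eq_bigr => b Pb.
    rewrite (bigD1 (Ordinal (sumP b Pb))) ?Pb ?eqxx //= [X in _ = _ + X]big1 ?addr0 //.
    by move=> k; rewrite -val_eqE /= eq_sym => /andP[/eqP ->]; rewrite eqxx.
  apply: eq_bigr => k _.
  have := coef_prod_expfactor w j (ltn_ord k).
  move=> /(congr1 (fun p : {poly R} => p`_j)); rewrite coef_prod_expfactor_expand coefCM => E.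
  rewrite [_ / _]mulrC -E mulr_sumr; apply: eq_bigl => b; exact: andbC.
pose nb (b : {ffun 'I_j -> 'I_j.+1}) (m : nat) : nat := if insub m is Some i then b i else 0%N.
have nbE b (i : 'I_j) : nb b i = b i.
  by rewrite /nb; case: insubP => [k _ /val_inj -> //|]; rewrite ltn_ord.
have AE b (i : 'I_j) : adom_alpha b i = b i := nbE b i.
have Aj (b : {ffun 'I_j -> 'I_j.+1}) : adom_alpha b j = 0%N.
  by rewrite /adom_alpha; case: insubP => // i; rewrite ltnn.
(* [h] passes from [alpha] to the multiplicities [alpha_i - alpha_{i+1}];
   its inverse [h'] takes suffix sums. *)
pose h (al : {ffun 'I_j -> 'I_j.+1}) : {ffun 'I_j -> 'I_j.+1} :=
  [ffun i : 'I_j => inord (adom_alpha al i - adom_alpha al i.+1)].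
pose h' (b : {ffun 'I_j -> 'I_j.+1}) : {ffun 'I_j -> 'I_j.+1} :=
  [ffun i : 'I_j => inord (\sum_(i <= m < j) nb b m)].
have hE al i : h al i = (adom_alpha al i - adom_alpha al i.+1)%N :> nat.
  rewrite ffunE inordK // (leq_ltn_trans (leq_subr _ _)) // AE; exact: ltn_ord.
have sumnb b : (\sum_(0 <= m < j) nb b m = \sum_(i < j) b i)%N.
  by rewrite big_mkord; apply: eq_bigr => i _; rewrite nbE.
have sufP b i : P b -> (i <= j)%N -> (\sum_(i <= m < j) nb b m < j.+1)%N.
  move=> Pb ij; apply: leq_ltn_trans (sumP b Pb).
  by rewrite -sumnb (@big_cat_nat _ _ _ i 0 j) //= leq_addl.
have h'A b i : P b -> (i <= j)%N -> adom_alpha (h' b) i = (\sum_(i <= m < j) nb b m)%N.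
  move=> Pb; rewrite leq_eqVlt => /predU1P[->|ij]; first by rewrite Aj big_geq.
  have := AE (h' b) (Ordinal ij) => /= ->; rewrite ffunE inordK //=.
  by apply: sufP => //; exact: ltnW.
have hh' b : P b -> h (h' b) = b.
  move=> Pb; apply/ffunP => i; apply/val_inj; rewrite /= hE.
  rewrite !h'A ?(ltnW (ltn_ord i)) // big_ltn //= nbE; exact: addnK.
rewrite (reindex_onto h h' hh'); apply: eq_big => [al|al /andP[_ /forallP ok]]; last first.
  have mono m : (m < j)%N -> (adom_alpha al m.+1 <= adom_alpha al m)%N.
    by move=> mj; exact: (ok (Ordinal mj)).
  have -> : (\sum_(i < j) h al i)%N = adom_alpha al 0.
    under eq_bigr do rewrite hE.
    rewrite -(big_mkord xpredT (fun i => adom_alpha al i - adom_alpha al i.+1)%N).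
    by rewrite sum_decrements // Aj subn0.
  by congr (_ * _); apply: eq_bigr => i _; rewrite hE.
apply/idP/idP => [/andP[/eqP sal /forallP ok]|/andP[Ph /eqP hal]].
  have mono m : (m < j)%N -> (adom_alpha al m.+1 <= adom_alpha al m)%N.
    by move=> mj; exact: (ok (Ordinal mj)).
  have suf i : (i <= j)%N -> (\sum_(i <= m < j) nb (h al) m)%N = adom_alpha al i.
    move=> ij; have := sum_decrements ij mono; rewrite Aj subn0 => <-.
    apply: eq_big_nat => m /andP[_ mj].
    by have := nbE (h al) (Ordinal mj) => /= ->; rewrite hE.
  apply/andP; split.
    apply/eqP; rewrite -[RHS]sal.
    transitivity (\sum_(i < j) i.+1 * nb (h al) i)%N.
      by apply: eq_bigr => i _; rewrite nbE.
    rewrite -sum_suffix; apply: eq_bigr => i _; apply: suf; exact: ltnW.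
  apply/eqP/ffunP => i; apply: val_inj; rewrite ffunE /= suf ?(ltnW (ltn_ord i)) //.
  by rewrite AE inordK.
- rewrite -hal; apply/andP; split.
    apply/eqP; rewrite -[RHS](eqP Ph).
    transitivity (\sum_(i < j) i.+1 * nb (h al) i)%N; last first.
      by apply: eq_bigr => i _; rewrite nbE.
    rewrite -sum_suffix; apply: eq_bigr => i _; apply: h'A => //; exact: ltnW.
  apply/forallP => i; rewrite !h'A ?(ltnW (ltn_ord i)) //.
  by rewrite [X in (_ <= X)%N]big_ltn //= leq_addl.
Qed.

End Adomian.

(** * Coefficientwise domination of polynomials *)

Section PolyBounds.
Context {R : realType}.
Implicit Types (p q : {poly R}) (w v : nat -> R).

Lemma coef_tailpoly w M i : (tailpoly w M)`_i = if (0 < i <= M)%N then w i else 0.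
Proof.
rewrite coef_sum; case: ifP => [/andP[i0 iM]|iM].
  have iM' : (i.-1 < M)%N by rewrite prednK.
  rewrite (bigD1 (Ordinal iM')) //= prednK // coefCM coefXn eqxx mulr1 big1 ?addr0 // => k.
  rewrite -val_eqE /= coefCM coefXn => ki; case: eqP => [ik|]; rewrite ?mulr0 //.
  by rewrite ik eqxx in ki.
apply: big1 => k _; rewrite coefCM coefXn; case: eqP => [ik|]; rewrite ?mulr0 //.
by rewrite ik ltn_ord in iM.
Qed.

Lemma coefM_le p p' q q' : (forall i, `|p`_i| <= p'`_i) -> (forall i, `|q`_i| <= q'`_i) ->
  forall i, `|(p * q)`_i| <= (p' * q')`_i.
Proof.
move=> pp qq i; rewrite !coefM; apply: (le_trans (ler_norm_sum _ _ _)).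
by apply: ler_sum => k _; rewrite normrM ler_pM.
Qed.

Lemma coefX_le p q : (forall i, `|p`_i| <= q`_i) -> forall k i, `|(p ^+ k)`_i| <= (q ^+ k)`_i.
Proof.
move=> pq; elim=> [|k IH] i; last by rewrite !exprS; exact: coefM_le.
by rewrite !expr0 coef1 normr_nat.
Qed.

Lemma eq_coefX p q j : (forall i, (i <= j)%N -> p`_i = q`_i) ->
  forall k i, (i <= j)%N -> (p ^+ k)`_i = (q ^+ k)`_i.
Proof.
move=> pq; elim=> [|k IH] i ij; first by rewrite !expr0.
rewrite !exprS !coefM; apply: eq_bigr => l _.
have li : (l <= i)%N by rewrite -ltnS.
by rewrite pq ?(leq_trans li) // IH // (leq_trans (leq_subr _ _)).
Qed.

Lemma coefX_small p k j : p`_0 = 0 -> (j < k)%N -> (p ^+ k)`_j = 0.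
Proof.
move=> p0; elim: k j => // k IH j; rewrite ltnS => jk.
rewrite exprS coefM big1 // => -[[|l] lj] _ /=; first by rewrite p0 mul0r.
by rewrite IH ?mulr0 // (leq_trans _ jk) // ltn_subrL /= (leq_ltn_trans (leq0n l)).
Qed.

(** Two gradings at once: a coefficient of the [k]-th power is homogeneous of degree [k] in the
    [w_p] and of weight [i] in their indices. *)
Lemma coefX_tailpoly_scale w v (kap rho : R) M : (forall i, (0 < i)%N -> w i = kap * rho ^+ i * v i) ->
  forall k i, (tailpoly w M ^+ k)`_i = kap ^+ k * rho ^+ i * (tailpoly v M ^+ k)`_i.
Proof.
move=> wv; elim=> [|k IH] i.
  by rewrite !expr0 coef1 mul1r; case: i => [|i]; rewrite ?mulr0 // expr0 mulr1.
rewrite !exprS !coefM mulr_sumr; apply: eq_bigr => l _.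
rewrite IH !coef_tailpoly; case: ifP => [/andP[l0 _]|_]; last by rewrite !mul0r mulr0.
have -> : rho ^+ i = rho ^+ l * rho ^+ (i - l) by rewrite -exprD subnKC // -ltnS.
by rewrite wv //; ring.
Qed.

Lemma adomian_ge0 Gd j w : (forall k, 0 <= Gd k (w 0%N)) ->
  (forall i, (i <= j)%N -> 0 <= w i) -> 0 <= adomian Gd j w.
Proof.
move=> G0 w0; rewrite adomianE; apply: sumr_ge0 => k _.
rewrite mulr_ge0 // divr_ge0 //.
apply: le_trans (coefX_le (p := tailpoly w j) _ _ _) => // i.
rewrite coef_tailpoly; case: ifP => [/andP[_ ij]|_]; rewrite ?normr0 // ger0_norm //.
exact: w0.
Qed.

(** For [0 < j] the term of degree 0 vanishes, and [kap ^ k <= kap] for the others. The bound thus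
    keeps one factor [kap], as in the hypotheses on the [w i], which is what an induction on [j]
    requires. *)
Lemma adomian_le (Gd Hd : nat -> R -> R) j w v (kap rho : R) : (0 < j)%N ->
  0 <= kap <= 1 -> 0 <= rho ->
  (forall k, `|Gd k (w 0%N)| <= Hd k (v 0%N)) -> (forall i, 0 <= v i) ->
  (forall i, (0 < i <= j)%N -> `|w i| <= kap * rho ^+ i * v i) ->
  `|adomian Gd j w| <= kap * rho ^+ j * adomian Hd j v.
Proof.
move=> j0 /andP[k0 k1] r0 GH v0 wv.
rewrite !adomianE; apply: (le_trans (ler_norm_sum _ _ _)).
rewrite mulr_sumr; apply: ler_sum => k _.
case: k => [[|k] kj] /=.
  by rewrite !expr0 coef1 gtn_eqF // mul0r !mulr0 normr0.
have vk i : 0 <= (tailpoly v j ^+ i)`_j.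
  apply: le_trans (coefX_le (p := tailpoly v j) _ _ _) => // l.
  by rewrite coef_tailpoly; case: ifP => _; rewrite ?normr0 // ger0_norm.
rewrite normrM mulrCA; apply: ler_pM => //.
rewrite normrM normfV [`|_%:R|]ger0_norm // mulrA ler_wpM2r ?invr_ge0 //.
apply: (le_trans (coefX_le (q := tailpoly (fun i => kap * rho ^+ i * v i) j) _ _ _)).
  by move=> i; rewrite !coef_tailpoly; case: ifP => [|_]; rewrite ?normr0 // => /wv.
rewrite (@coefX_tailpoly_scale _ v kap rho) // ler_wpM2r // ler_wpM2r ?exprn_ge0 //.
by rewrite exprS ler_piMr // exprn_ile1.
Qed.

(** On the coefficients of index [i >= m] the weight [rho ^ (i - m)] is at least 1. This estimate
    serves for Cauchy products as well as for compositions. *)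
Lemma poly_tail_le p q (rho : R) m : 1 <= rho -> (forall i, `|p`_i| <= q`_i) ->
  `|p.[1] - \sum_(j < m) p`_j| <= rho^-1 ^+ m * q.[rho].
Proof.
move=> r1 pq; have r0 : 0 < rho by exact: lt_le_trans r1.
have q0 i : 0 <= q`_i by exact: le_trans (pq i).
have [k [hp hq]] : exists k, (size p <= m + k)%N /\ (size q <= m + k)%N.
  by exists (size p + size q)%N; rewrite addnCA leq_addr addnCA addnA leq_addl.
rewrite (horner_coef_wide _ hp) (horner_coef_wide _ hq).
rewrite !big_split_ord /= addrAC.
under eq_bigr do rewrite expr1n mulr1.
rewrite subrr add0r mulrDr.
apply: ler_wpDl.
  by rewrite mulr_ge0 ?exprn_ge0 ?invr_ge0 ?(ltW r0) // sumr_ge0 // => i _; rewrite mulr_ge0 // exprn_ge0 // ltW.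
apply: (le_trans (ler_norm_sum _ _ _)).
rewrite mulr_sumr; apply: ler_sum => i _; rewrite expr1n mulr1.
rewrite exprD mulrCA [q`_ _ * _]mulrC !mulrA -exprMn mulVf ?gt_eqF // expr1n mul1r.
by apply: (le_trans (pq _)); rewrite ler_peMl // exprn_ege1.
Qed.

(** Taylor expansion of [p] at [w 0]: powers of [tailpoly] beyond the [j]-th do not reach degree
    [j], and in degree [j] the truncations at [M] and at [j] cannot be told apart. *)
Lemma coef_comp_poly_adomian p w M j : (j <= M)%N ->
  (p \Po ((w 0%N)%:P + tailpoly w M))`_j = adomian (fun k => horner p^`(k)) j w.
Proof.
move=> jM; rewrite adomianE /comp_poly.
pose n := (j.+1 + size p)%N.
rewrite (@nderiv_taylor_wide _ n) ?size_map_polyC ?leq_addl //; last exact: mulrC.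
rewrite coef_sum /n big_split_ord /= [X in _ + X]big1 ?addr0; last first.
  move=> i _; rewrite nderivn_map horner_map coefCM coefX_small ?mulr0 //.
    by rewrite coef_tailpoly.
  by rewrite addSn ltnS leq_addr.
apply: eq_bigr => k _; rewrite nderivn_map horner_map coefCM nderivn_def hornerMn.
rewrite (@eq_coefX _ (tailpoly w j) j) //; last first.
  by move=> i ij; rewrite !coef_tailpoly ij (leq_trans ij).
by rewrite -[_ *+ _]mulr_natr mulrACA divff ?mulr1 // pnatr_eq0 -lt0n fact_gt0.
Qed.

End PolyBounds.

(** * Entire series and sums of Adomian polynomials *)

Section Entire.
Context {R : realType}.
Implicit Types (c w : nat -> R).

Lemma sum_seriesE (u : nat -> R) : (fun n => \sum_(i < n) u i) = series u.
Proof. by apply/funext => n; rewrite /series /= big_mkord. Qed.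

Lemma cvg_le_ub (u : nat -> R) (l b : R) : u @ \oo --> l -> (forall n, u n <= b) -> l <= b.
Proof.
by move=> ul ub; apply: (cvgr_to_le ul); exact: nearW.
Qed.

Lemma is_cvg_series_geometric_bound (u : nat -> R) (A r : R) : 0 <= r < 1 ->
  (forall n, `|u n| <= A * r ^+ n) -> cvgn (series u).
Proof.
move=> /andP[r0 r1] ur; apply: normed_cvg.
apply: (@series_le_cvg _ _ (geometric A r)) => [n|n|n|] //=.
  exact: le_trans (ur n).
by apply: is_cvg_geometric_series; rewrite ger0_norm.
Qed.

Lemma cvg_sum_ord m (F : nat -> nat -> R) (l : nat -> R) :
  (forall j, (j < m)%N -> (fun n => F n j) @ \oo --> l j) ->
  (fun n => \sum_(j < m) F n j) @ \oo --> \sum_(j < m) l j.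
Proof.
elim: m => [|m IH] hF.
  by under eq_fun do rewrite big_ord0; rewrite big_ord0; exact: cvg_cst.
under eq_fun do rewrite big_ord_recr; rewrite big_ord_recr; apply: cvgD; last exact: hF.
by apply: IH => j jm; apply: hF; exact: ltnW.
Qed.

Definition entire c := forall x : R, cvgn (pseries c x).

Lemma entire_norm c (x : R) : entire c -> cvgn (series (fun i => `|c i| * x ^+ i)).
Proof.
move=> ec; apply: (@is_cvg_pseries_inside_norm _ _ (`|x| + 1)) => //.
by rewrite [X in _ < X]ger0_norm ?ltrDl // addr_ge0.
Qed.

Lemma entire_diffs c : entire c -> entire (pseries_diffs c).
Proof.
move=> ec x; pose r := `|x| + 1.
have r0 : 0 < r by rewrite ltr_wpDl.
(* Boundedness of the terms at [4 r] suffices: the factor [i + 1 <= 2 ^ (i + 1)] from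
   differentiation costs a ratio 2, and a ratio 1/2 remains. *)
have [M hM] : exists M, forall i, `|c i * (4 * r) ^+ i| <= M.
  have [M0 [_ hM]] := cvg_series_bounded (ec (4 * r)).
  by exists (M0 + 1) => i; apply: hM => //; rewrite ltrDl.
have M0 : 0 <= M by apply: le_trans (hM 0%N).
apply: (@is_cvg_series_geometric_bound _ (M / (2 * r)) (2^-1)); first by apply/andP; split; lra.
move=> i; rewrite /pseries_diffs !normrM normrX normr_nat.
have h1 : i.+1%:R <= 2 ^+ i.+1 :> R by rewrite -natrX ler_nat ltnW // ltn_expl.
have h2 : `|c i.+1| <= M / (4 * r) ^+ i.+1.
  rewrite ler_pdivlMr ?exprn_gt0 ?mulr_gt0 //.
  by move: (hM i.+1); rewrite normrM [X in _ * X]ger0_norm // exprn_ge0 // mulr_ge0 // ltW.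
have h3 : `|x| ^+ i <= r ^+ i by rewrite lerXn2r ?nnegrE ?(ltW r0) // lerDl.
apply: (@le_trans _ _ (2 ^+ i.+1 * (M / (4 * r) ^+ i.+1) * r ^+ i)).
  by rewrite ler_pM ?mulr_ge0 // ler_pM.
rewrite le_eqVlt; apply/orP; left; apply/eqP.
rewrite (_ : 4 * r = 2 * (2 * r)); last by ring.
rewrite !exprMn !exprS exprVn; field.
by rewrite !expf_neq0 ?gt_eqF.
Qed.

Lemma entire_iter_diffs c k : entire c -> entire (iter k (@pseries_diffs R) c).
Proof. by move=> ec; elim: k => //= k; exact: entire_diffs. Qed.

Definition entire_fun c (x : R) : R := limn (pseries c x).

Lemma is_derive_entire c (x : R) : entire c ->
  is_derive x 1 (entire_fun c) (entire_fun (pseries_diffs c) x).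
Proof.
move=> ec; apply: (@pseries_snd_diffs _ c (`|x| + 1) x).
- exact: ec.
- exact: entire_diffs.
- by do 2 apply: entire_diffs.
- by rewrite [X in _ < X]ger0_norm ?ltrDl // addr_ge0.
Qed.

Lemma continuous_entire c : entire c -> continuous (entire_fun c).
Proof.
move=> ec x; apply: differentiable_continuous; apply/derivable1_diffP.
by have [] := is_derive_entire x ec.
Qed.

Lemma derive1n_entire c k : entire c ->
  derive1n k (entire_fun c) = entire_fun (iter k (@pseries_diffs R) c).
Proof.
move=> ec; elim: k => // k IH; rewrite derive1nS IH; apply/funext => x.
have := is_derive_entire x (@entire_iter_diffs _ k ec) => h.
by rewrite derive1E derive_val.
Qed.

Lemma cvg_derivn_poly c k (x : R) : entire c ->
  (fun n => (\poly_(i < n) c i)^`(k).[x]) @ \oo --> derive1n k (entire_fun c) x.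
Proof.
move=> ec; rewrite derive1n_entire //.
have E n : (\poly_(i < n) c i)^`(k) = \poly_(i < n - k) iter k (@pseries_diffs R) c i.
  elim: k => [|k IH]; first by rewrite subn0.
  rewrite derivnS IH; apply/polyP => i; rewrite coef_deriv !coef_poly subnS ltn_predRL.
  by case: ifP => _; rewrite ?mul0rn // /pseries_diffs /= mulr_natl.
have -> : (fun n => (\poly_(i < n) c i)^`(k).[x]) =
    (fun n => pseries (iter k (@pseries_diffs R) c) x (n - k)%N).
  by apply/funext => n; rewrite E horner_poly /pseries /series /= big_mkord.
have := @entire_iter_diffs _ k ec x => cv.
by apply: (@cvg_comp _ _ _ (fun n => n - k)%N _ _ _ _ _ cv); exact: cvg_subnr.
Qed.

Lemma coef_comp_le (p p' q q' : {poly R}) : (forall i, `|p`_i| <= p'`_i) ->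
  (forall i, `|q`_i| <= q'`_i) -> forall i, `|(p \Po q)`_i| <= (p' \Po q')`_i.
Proof.
move=> pp qq i; rewrite /comp_poly.
pose n := (size p + size p')%N.
rewrite (@horner_coef_wide _ n (map_poly _ p)) ?size_map_polyC ?leq_addr //.
rewrite (@horner_coef_wide _ n (map_poly _ p')) ?size_map_polyC ?leq_addl //.
rewrite !coef_sum; apply: (le_trans (ler_norm_sum _ _ _)); apply: ler_sum => k _.
by rewrite !coef_map !coefCM normrM ler_pM // coefX_le.
Qed.

(** For a polynomial in place of the entire function, the difference is the sum of the coefficients
    of index above [M] of a composition, controlled by its value at [rho] after passing to absolute
    values. This value is at most [\sum |c_i| T^i] whatever the degree [n], so the estimate survives
    the limit in [n]. *)
Lemma adomian_partial_sums c w (rho T : R) M : entire c -> 1 <= rho ->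
  \sum_(p < M.+1) `|w p| * rho ^+ p <= T ->
  `|entire_fun c (\sum_(p < M.+1) w p)
    - \sum_(j < M.+1) adomian (fun k => derive1n k (entire_fun c)) j w|
  <= rho^-1 ^+ M.+1 * limn (series (fun i => `|c i| * T ^+ i)).
Proof.
move=> ec r1 hT.
have r0 : 0 <= rho by apply: le_trans r1.
have T0 : 0 <= T by apply: le_trans hT; apply: sumr_ge0 => i _; rewrite mulr_ge0 ?exprn_ge0.
pose P (u : nat -> R) := (u 0%N)%:P + tailpoly u M.
have PE u x : (P u).[x] = \sum_(p < M.+1) u p * x ^+ p.
  rewrite /P hornerD hornerC big_ord_recl /= expr0 mulr1; congr (_ + _).
  by rewrite /tailpoly horner_sum; apply: eq_bigr => i _; rewrite hornerCM hornerXn.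
have coefP u i : (P u)`_i = if (i <= M)%N then u i else 0.
  rewrite coefD coefC coef_tailpoly; case: i => [|i] /=; first by rewrite addr0.
  by rewrite add0r.
have key n : `|(\poly_(i < n) c i).[\sum_(p < M.+1) w p] -
    \sum_(j < M.+1) adomian (fun k => horner (\poly_(i < n) c i)^`(k)) j w|
  <= rho^-1 ^+ M.+1 * limn (series (fun i => `|c i| * T ^+ i)).
  have -> : \sum_(p < M.+1) w p = (P w).[1].
    by rewrite PE; apply: eq_bigr => i _; rewrite expr1n mulr1.
  rewrite -horner_comp.
  under eq_bigr => j _ do rewrite -(@coef_comp_poly_adomian _ _ _ M) -1?ltnS //.
  apply: (le_trans (@poly_tail_le _ _ (\poly_(i < n) `|c i| \Po P (fun p => `|w p|)) rho _ r1 _)).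
    apply: coef_comp_le => i; first by rewrite !coef_poly; case: ifP; rewrite ?normr0.
    by rewrite !coefP; case: ifP; rewrite ?normr0.
  apply: ler_wpM2l; first by rewrite exprn_ge0 // invr_ge0.
  rewrite horner_comp PE horner_poly.
  apply: (@le_trans _ _ (series (fun i => `|c i| * T ^+ i) n)).
    rewrite /series /= big_mkord; apply: ler_sum => i _; apply: ler_wpM2l => //.
    by rewrite lerXn2r // nnegrE; apply: sumr_ge0 => p _; rewrite mulr_ge0 ?exprn_ge0.
  apply: nondecreasing_cvgn_le; last exact: entire_norm.
  apply/nondecreasing_seqP => m; rewrite /series /= big_nat_recr //= lerDl.
  by rewrite mulr_ge0 ?exprn_ge0.
apply: (cvg_le_ub _ key); apply: cvg_norm; apply: cvgB; first exact: (@cvg_derivn_poly c 0).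
apply: (@cvg_sum_ord _ (fun n j => adomian (fun k => horner (\poly_(i < n) c i)^`(k)) j w)
  (fun j => adomian (fun k => derive1n k (entire_fun c)) j w)) => j _.
under eq_fun do rewrite adomianE; rewrite adomianE.
apply: (@cvg_sum_ord _ (fun n k => (\poly_(i < n) c i)^`(k).[w 0%N] * ((tailpoly w j ^+ k)`_j / k`!%:R))
  (fun k => derive1n k (entire_fun c) (w 0%N) * ((tailpoly w j ^+ k)`_j / k`!%:R))) => k _.
by apply: cvgMr_tmp; exact: cvg_derivn_poly.
Qed.

Lemma sum_adomian c w (rho T h : R) : entire c -> 1 < rho ->
  (forall M, \sum_(p < M) `|w p| * rho ^+ p <= T) ->
  (fun m => \sum_(p < m) w p) @ \oo --> h ->
  (fun m => \sum_(j < m) adomian (fun k => derive1n k (entire_fun c)) j w) @ \oo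
    --> entire_fun c h.
Proof.
move=> ec r1 hT hw; rewrite -cvg_shiftS.
have fw : (fun m => entire_fun c (\sum_(p < m.+1) w p)) @ \oo --> entire_fun c h.
  by apply: continuous_cvg; [exact: continuous_entire|by rewrite (cvg_shiftS (fun m => \sum_(p < m) w p))].
apply: cvg_sub0 fw; apply/norm_cvg0P.
pose B := limn (series (fun i => `|c i| * T ^+ i)).
apply: (@squeeze_cvgr _ _ _ _ (cst 0) (fun m => rho^-1 ^+ m.+1 * B)).
- apply: nearW => m /=; rewrite normr_ge0 /= distrC.
  by apply: adomian_partial_sums => //; exact: ltW.
- exact: cvg_cst.
- rewrite -[X in _ --> X](mul0r B); apply: cvgMr_tmp.
  rewrite (cvg_shiftS (fun m => rho^-1 ^+ m)); apply: cvg_expr.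
  by rewrite ger0_norm ?invr_ge0 ?(ltW (lt_trans _ r1)) // invf_lt1 // (lt_trans _ r1).
Qed.

Lemma cvg_cauchy_product (x y : nat -> R) (rho A B a b : R) : 1 < rho ->
  (forall M, \sum_(p < M) `|x p| * rho ^+ p <= A) ->
  (forall M, \sum_(p < M) `|y p| * rho ^+ p <= B) ->
  (fun m => \sum_(p < m) x p) @ \oo --> a ->
  (fun m => \sum_(p < m) y p) @ \oo --> b ->
  (fun m => \sum_(j < m) \sum_(p < j.+1) x p * y (j - p)%N) @ \oo --> a * b.
Proof.
move=> r1 hA hB xa yb.
have r0 : 0 <= rho by apply: le_trans (ltW r1).
have A0 : 0 <= A by have := hA 0%N; rewrite big_ord0.
apply: cvg_sub0 (cvgM xa yb); apply/norm_cvg0P.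
apply: (@squeeze_cvgr _ _ _ _ (cst 0) (fun m => rho^-1 ^+ m * (A * B))).
- apply: nearW => m /=; rewrite normr_ge0 /= distrC.
  (* Truncating both factors below degree [m] does not change the product coefficients of index
     below [m], so the partial Cauchy sum is a partial sum of coefficients of one polynomial. *)
  have := @poly_tail_le _ (\poly_(i < m) x i * \poly_(i < m) y i)
     (\poly_(i < m) `|x i| * \poly_(i < m) `|y i|) rho m (ltW r1).
  rewrite !hornerM !horner_poly.
  under [X in `|X * _ - _|]eq_bigr do rewrite expr1n mulr1.
  under [X in `|_ * X - _|]eq_bigr do rewrite expr1n mulr1.
  have -> : \sum_(j < m) (\poly_(i < m) x i * \poly_(i < m) y i)`_j =
     \sum_(j < m) \sum_(p < j.+1) x p * y (j - p)%N.
    apply: eq_bigr => j _; rewrite coefM; apply: eq_bigr => p _.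
    by rewrite !coef_poly (leq_ltn_trans (leq_subr _ _)) // (leq_trans (ltn_ord p)).
  move=> H; apply: le_trans (H _) _.
    by apply: coefM_le => i; rewrite !coef_poly; case: ifP; rewrite ?normr0.
  rewrite ler_wpM2l ?exprn_ge0 ?invr_ge0 // ler_pM //;
    by apply: sumr_ge0 => i _; rewrite mulr_ge0 ?exprn_ge0.
- exact: cvg_cst.
- rewrite -[X in _ --> X](mul0r (A * B)); apply: cvgMr_tmp; apply: cvg_expr.
  by rewrite ger0_norm ?invr_ge0 // invf_lt1 // (lt_trans _ r1).
Qed.

End Entire.

(** * The majorant sequence *)

Section Majorant.
Context {R : realType}.
Implicit Types (v : nat -> R) (Nbar : R -> R) (qn : R).

Definition conv_sum v j : R := \sum_(1 <= p < j.+1) v (j.+1 - p)%N * v p.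

(* The value at 0 makes the recursion for [v 1] an instance of the general one;
   it is not [adomian] at 0, which would be [Nbar (v 0)]. *)
Definition nonlin_term (Nbar : R -> R) v j : R :=
  if j is 0 then derive1n 1 Nbar (v 0%N) * v 0%N
  else adomian (fun k => derive1n k Nbar) j v.

Lemma majorantS qn Nbar v j : majorant qn Nbar v ->
  v j.+1 = conv_sum v j + (1 + v 0%N) * (qn * v j + nonlin_term Nbar v j).
Proof.
move=> [_ [v1 vS]]; case: j => [|j]; last exact: vS.
by rewrite v1 /conv_sum big_geq // add0r.
Qed.

Lemma majorant_ge0 qn Nbar v : 0 <= qn ->
  (forall k (x : R), 0 <= x -> 0 <= derive1n k Nbar x) -> majorant qn Nbar v ->
  forall j, 0 <= v j.
Proof.
move=> q0 N0 mv j; have v0 : 0 <= v 0%N by rewrite mv.1; lra.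
elim/ltn_ind: j => -[//|j] IH.
rewrite (majorantS _ mv) addr_ge0 //.
  rewrite /conv_sum big_nat; apply: sumr_ge0 => p /andP[p1 pj]; rewrite mulr_ge0 // IH //.
  by rewrite ltn_subrL p1.
rewrite mulr_ge0 ?addr_ge0 // ?mulr_ge0 // ?IH //.
case: j IH => [|j] IH /=; first by apply: mulr_ge0 => //; exact: (N0 1%N).
by apply: adomian_ge0 => [k|i ij]; [exact: N0|exact: IH].
Qed.

Lemma nonlin_term_ge0 qn Nbar v : 0 <= qn ->
  (forall k (x : R), 0 <= x -> 0 <= derive1n k Nbar x) -> majorant qn Nbar v ->
  forall j, 0 <= nonlin_term Nbar v j.
Proof.
move=> q0 N0 mv; have v0 := majorant_ge0 q0 N0 mv.
case=> [|j] /=; first by apply: mulr_ge0 => //; exact: (N0 1%N).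
by apply: adomian_ge0 => // k; exact: N0.
Qed.

(** The product is a single summand of the convolution in the recursion for [v (i + j)], all other
    contributions being nonnegative. *)
Lemma majorant_supermul qn Nbar v : 0 <= qn ->
  (forall k (x : R), 0 <= x -> 0 <= derive1n k Nbar x) -> majorant qn Nbar v ->
  forall i j, (0 < i)%N -> (0 < j)%N -> v i * v j <= v (i + j)%N.
Proof.
move=> q0 N0 mv [//|i] j _ j0; have v0 := majorant_ge0 q0 N0 mv.
rewrite addSn [X in _ <= X](majorantS _ mv); apply: ler_wpDr.
  by rewrite mulr_ge0 ?addr_ge0 // ?mulr_ge0 // (nonlin_term_ge0 q0 N0 mv).
rewrite /conv_sum (bigD1_seq j) ?iota_uniq //=; last first.
  by rewrite mem_index_iota j0 ltnS leq_addl.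
rewrite -addSn addnK lerDl; apply: sumr_ge0 => p _; exact: mulr_ge0.
Qed.

Lemma conv_radius_gt v (x : R) : (x%:E < conv_radius v)%E ->
  exists2 r, x < r & exists A, 0 <= A /\ forall j, `|v j| * r ^+ j <= A.
Proof.
move=> /ereal_sup_gt[_ [r [r0 cv] <-]]; rewrite lte_fin => xr; exists r => //.
have := @cvg_series_bounded _ (fun j => `|v j| * r ^+ j); rewrite -sum_seriesE => /(_ cv).
move=> [M [_ hM]]; exists (`|M| + 1); split; first by rewrite addr_ge0.
move=> j; apply: le_trans (hM (`|M| + 1) _ j I); first exact: ler_norm.
by apply: ltr_pwDr; rewrite ?ler_norm.
Qed.

(* [v j ^ m <= v (m j)], so [v j > 0] would make the radius finite. *)
Lemma conv_radius_infty v : (forall j, 0 <= v j) ->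
  (forall i j, (0 < i)%N -> (0 < j)%N -> v i * v j <= v (i + j)%N) ->
  conv_radius v = +oo%E -> forall j, (0 < j)%N -> v j = 0.
Proof.
move=> v0 vM Roo j j0; apply/eqP; apply: contraT => vj.
have vjp : 0 < v j by rewrite lt_neqAle eq_sym vj v0.
have vpow m : v j ^+ m.+1 <= v (m.+1 * j)%N.
  elim: m => [|m IH]; first by rewrite mul1n.
  rewrite exprS mulSn; apply: le_trans (vM _ _ j0 _); last by rewrite muln_gt0.
  by rewrite ler_wpM2l.
(* Chosen so that [1 <= x] and [2 <= v j * x]: then [v j * r ^ j >= 2] for [r > x], and its powers
   are unbounded. *)
pose x := 1 + 2 / v j.
have [r xr [A [A0 hA]]] : exists2 r, x < r & exists A, 0 <= A /\ forall j, `|v j| * r ^+ j <= A.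
  by apply: conv_radius_gt; rewrite Roo ltry.
have x1 : 1 <= x by rewrite lerDl divr_ge0.
have big m : 2 ^+ m.+1 <= A.
  apply: le_trans (hA (m.+1 * j)%N); rewrite ger0_norm //.
  apply: (@le_trans _ _ (v j ^+ m.+1 * (r ^+ j) ^+ m.+1)).
    rewrite -exprMn lerXn2r ?nnegrE ?mulr_ge0 ?exprn_ge0 // ?(le_trans _ (ltW xr)) ?(le_trans _ x1) //.
    apply: (@le_trans _ _ (v j * x)); first by rewrite mulrDr mulr1 mulrCA divff // mulr1 lerDr.
    apply: ler_wpM2l => //; apply: (le_trans (ltW xr)).
    by rewrite ler_eXnr // (le_trans x1 (ltW xr)).
  rewrite -exprM [(j * _)%N]mulnC ler_wpM2r // exprn_ge0 // (le_trans _ (ltW xr)) // (le_trans _ x1) //.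
have := big (Num.bound A); rewrite leNgt => /negP; case.
apply: (lt_trans (archi_boundP A0)); rewrite -natrX ltr_nat.
by apply: ltn_trans (ltn_expl _ _).
Qed.

(** With [d = (1 - om) / 2] one has [om <= (1 - d) ^ 2], so it is enough to square a bound for
    [(1 - d) ^ m * (m + 1)], which comes from the Bernoulli-type inequality [h]. *)
Lemma geometric_vs_square (om : R) : 0 < om < 1 ->
  exists2 C, 0 <= C & forall m, om ^+ m * (m.+1)%:R ^+ 2 <= C.
Proof.
move=> /andP[p0 p1]; pose d := (1 - om) / 2.
have d0 : 0 < d by rewrite /d; lra.
have d1 : 0 <= 1 - d by rewrite /d; lra.
have h m : (1 - d) ^+ m * (m%:R * d + 1) <= 1.
  elim: m => [|m IH]; first by rewrite expr0 mul0r add0r mulr1.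
  apply: le_trans IH; rewrite exprSr -mulrA; apply: ler_wpM2l; first by rewrite exprn_ge0.
  by rewrite -natr1; have : 0 <= m%:R :> R by []; nra.
have h2 m : (1 - d) ^+ m * (m.+1)%:R <= d^-1.
  rewrite -[d^-1]mul1r ler_pdivlMr // -mulrA; apply: le_trans (h m).
  apply: ler_wpM2l; first by rewrite exprn_ge0.
  by rewrite -natr1 mulrDl mul1r lerD2l /d; lra.
exists (d^-1 ^+ 2) => [|m]; first by rewrite exprn_ge0 // invr_ge0 ltW.
apply: (@le_trans _ _ (((1 - d) ^+ m * (m.+1)%:R) ^+ 2)).
  rewrite [X in _ <= X]exprMn; apply: ler_wpM2r; first by rewrite exprn_ge0.
  rewrite exprAC; apply: lerXn2r; rewrite ?nnegrE ?exprn_ge0 ?(ltW p0) // /d.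
  nra.
by apply: lerXn2r; rewrite ?nnegrE ?mulr_ge0 ?exprn_ge0 ?invr_ge0 ?(ltW d0).
Qed.

Lemma sum_geometric_le (x : R) M : 0 <= x < 1 -> \sum_(i < M) x ^+ i <= (1 - x)^-1.
Proof.
move=> /andP[x0 x1]; rewrite -[_^-1]mul1r ler_pdivlMr ?subr_gt0 // mulrC.
by rewrite -opprB mulNr -subrX1 opprB lerBlDr lerDl exprn_ge0.
Qed.

(** The two factors [om] have different tasks. One moves the estimate of [v] to the radius [om R],
    strictly inside the disc of convergence; the other leaves [om ^ (m + i)], which is summable in
    [i] and beats [(m + 1) ^ 2] in [m]. *)
Lemma majorant_tail v (om K : R) : 0 < om < 1 -> (forall j, 0 <= v j) ->
  (forall i j, (0 < i)%N -> (0 < j)%N -> v i * v j <= v (i + j)%N) ->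
  0 < K -> (K%:E < conv_radius v)%E ->
  let rn := K * invR (conv_radius v) in
  exists2 c, 0 < c & forall m M,
    \sum_(i < M) (om ^+ 2 * K) ^+ (m + i) * v (m + i).+1 <=
      c / (1 - rn) / powR (m.+1)%:R (1 + 1) * invR (conv_radius v) * rn ^+ m.
Proof.
move=> /[dup] om01 /andP[om0 om1] v0 vM K0 KR.
have [C2 C20 hC2] := geometric_vs_square om01.
case E : (conv_radius v) KR => [r| |] //=; rewrite ?lte_fin => KR; last first.
  (* Infinite radius: [invR] is 0, hence so is the right-hand side, and the left-hand side vanishes
     because [v] does from index 1 on. *)
  exists 1 => // m M; rewrite mulr0 mul0r big1 // => i _.
  by rewrite (conv_radius_infty v0 vM E) ?mulr0.
have r0 : 0 < r := lt_trans K0 KR.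
set rn := K * r^-1.
have rn0 : 0 < rn by rewrite mulr_gt0 ?invr_gt0.
have rn1 : rn < 1 by rewrite ltr_pdivrMr // mul1r.
have omr : om * r < r by rewrite gtr_pMl.
have [r1 r1r [A [A0 hA]]] : exists2 r1, om * r < r1 &
    exists A, 0 <= A /\ forall j, `|v j| * r1 ^+ j <= A.
  by apply: conv_radius_gt; rewrite E lte_fin.
have or0 : 0 < om * r by rewrite mulr_gt0.
have vA j : v j <= A / (om * r) ^+ j.
  rewrite ler_pdivlMr ?exprn_gt0 //; apply: le_trans (hA j).
  rewrite ger0_norm // ler_wpM2l // lerXn2r ?nnegrE ?(ltW or0) ?(ltW r1r) //.
  exact: le_trans (ltW or0) (ltW r1r).
(* [A] bounds the terms at [om r], [1 / (1 - om)] sums over [i], [1 / om] pays for the index shift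
   in [v (m + i).+1], [C2] absorbs the square; adding 1 makes the constant positive. *)
exists (A / (1 - om) / om * C2 + 1); first by rewrite ltr_wpDl // !mulr_ge0 ?invr_ge0 ?subr_ge0 // ltW.
move=> m M.
have -> : powR (m.+1)%:R (1 + 1) = (m.+1)%:R ^+ 2 :> R by rewrite -powR_mulrn.
have term i : (om ^+ 2 * K) ^+ (m + i) * v (m + i).+1 <=
   A / om / r * om ^+ m * rn ^+ m * om ^+ i.
  apply: (@le_trans _ _ ((om ^+ 2 * K) ^+ (m + i) * (A / (om * r) ^+ (m + i).+1))).
    by rewrite ler_wpM2l // exprn_ge0 // mulr_ge0 ?(ltW K0) // exprn_ge0 // ltW.
  apply: (@le_trans _ _ (A / om / r * (om ^+ (m + i) * rn ^+ (m + i)))).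
    rewrite le_eqVlt; apply/orP; left; apply/eqP.
    rewrite /rn; move: (m + i)%N => n.
    have -> : (om * r) ^+ n.+1 = om * r * (om ^+ n * r ^+ n) by rewrite exprS exprMn.
    have -> : (om ^+ 2 * K) ^+ n = om ^+ n * om ^+ n * K ^+ n by rewrite expr2 !exprMn.
    have -> : (K / r) ^+ n = K ^+ n / r ^+ n by rewrite exprMn exprVn.
    by field; rewrite !expf_neq0 ?gt_eqF.
  rewrite -!mulrA; apply: ler_wpM2l => //; apply: ler_wpM2l; first by rewrite invr_ge0 ltW.
  apply: ler_wpM2l; first by rewrite invr_ge0 ltW.
  rewrite !exprD -!mulrA ler_wpM2l ?exprn_ge0 ?(ltW om0) // mulrCA ler_wpM2l ?exprn_ge0 ?(ltW rn0) //.
  by rewrite ler_piMr ?exprn_ge0 ?(ltW om0) // exprn_ile1 // ltW.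
pose D := A / om / r * om ^+ m * rn ^+ m.
apply: (@le_trans _ _ (D * \sum_(i < M) om ^+ i)).
  by rewrite mulr_sumr; apply: ler_sum => i _; exact: term.
have D0 : 0 <= D by rewrite /D !mulr_ge0 ?exprn_ge0 ?invr_ge0 ?(ltW r0) ?(ltW rn0) ?(ltW om0).
apply: (@le_trans _ _ (D / (1 - om))).
  by rewrite ler_wpM2l // sum_geometric_le // om1 ltW.
rewrite /D.
have -> : A / om / r * om ^+ m * rn ^+ m / (1 - om) =
   A / (1 - om) / om * (om ^+ m) * r^-1 * rn ^+ m by ring.
rewrite ler_wpM2r ?exprn_ge0 ?(ltW rn0) // ler_wpM2r ?invr_ge0 ?(ltW r0) //.
rewrite ler_pdivlMr ?exprn_gt0 // ler_pdivlMr ?subr_gt0 //.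
set B := A / (1 - om) / om.
have B0 : 0 <= B by rewrite /B !mulr_ge0 ?invr_ge0 ?subr_ge0 // ltW.
apply: (@le_trans _ _ (B * C2)); last by rewrite lerDl.
rewrite -2!mulrA; apply: ler_wpM2l => //; rewrite mulrA.
apply: (le_trans _ (hC2 m)); rewrite ler_piMr ?mulr_ge0 ?exprn_ge0 ?(ltW om0) //.
by rewrite lerBlDr lerDl ltW.
Qed.

Lemma cvg_series_tail_le (x y : nat -> R) (l b : R) m :
  (forall j, `|x j.+1| <= y j) -> (forall M, \sum_(i < M) y (m + i)%N <= b) ->
  (fun m => \sum_(j < m) x j) @ \oo --> l -> `|l - \sum_(j < m.+1) x j| <= b.
Proof.
move=> xy yb xl.
have key n : `|\sum_(j < n + m.+1) x j - \sum_(j < m.+1) x j| <= b.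
  rewrite addnC big_split_ord /= addrAC subrr add0r; apply: (le_trans (ler_norm_sum _ _ _)).
  by apply: le_trans (yb n); apply: ler_sum => i _; rewrite addSn.
apply: (cvg_le_ub _ key); apply: cvg_norm; apply: cvgB; last exact: cvg_cst.
by move: xl; rewrite -(@cvg_shiftn m.+1).
Qed.

End Majorant.

(** * A priori bounds for the corrections *)

Section Iteration.
Context {R : realType}.
Local Notation leb := (@lebesgue_measure R).
Local Notation int a b f := (\int[leb]_(t in `[a, b]%classic) f t).

Lemma adomian0 (Gd : nat -> R -> R) w : adomian Gd 0 w = Gd 0%N (w 0%N).
Proof. by rewrite adomianE big_ord_recl big_ord0 addr0 /= expr0 coef1 fact0 divr1 mulr1. Qed.

Lemma int_sin2_le (s x : R) : 0 < s -> 0 <= x <= 1 ->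
  int 0 x (fun t => sin (s * (x - t)) ^+ 2) <= x / 2 + (4 * s)^-1.
Proof.
move=> s0 /andP[x0 x1].
have -> : int 0 x (fun t => sin (s * (x - t)) ^+ 2) =
    - int 0 x (fun t => sin (s * x - s * t) * sin (- (s * x) + s * t)).
  rewrite -mulN1r -intZ; last first.
    apply: (@L1on_ext _ _ _ (fun t => sin (s * x + (- s) * t) * sin (- (s * x) + s * t))).
      by move=> t _; rewrite mulNr.
    apply: L1onM; first exact: continuous_sin_affine.
    by apply: L1on_continuous; exact: continuous_sin_affine.
  apply: int_ext => t _.
  rewrite (_ : - (s * x) + s * t = - (s * (x - t))); last by ring.
  rewrite sinN mulrN mulN1r opprK expr2; congr (sin _ * _); ring.
rewrite int_sin_sin ?gt_eqF // subrr cos0 mulr0 !subr0.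
rewrite (_ : s * x - - (s * x) - 2 * s * x = 0); last by ring.
rewrite sin0 subr0 mul1r.
set S := sin _; have S1 : - S <= 1 by rewrite lerNl sin_geN1.
rewrite [X in X <= _](_ : _ = x / 2 + - S * (4 * s)^-1); last by field; rewrite gt_eqF.
by rewrite lerD2l ler_piMl // invr_ge0 mulr_ge0 // ltW.
Qed.

Lemma int_abs_sin_le (s x : R) : 4 <= s -> 0 <= x <= 1 ->
  int 0 x (fun t => `|sin (s * (x - t))|) <= 3 / 4.
Proof.
move=> s4 x01; have [x0 x1] := andP x01; have s0 : 0 < s by apply: lt_le_trans s4.
have cs : continuous (fun t => sin (s * (x - t))).
  rewrite (_ : (fun t => _) = (fun t => sin (s * x + (- s) * t))).
    exact: continuous_sin_affine.
  by apply/funext => t; congr sin; ring.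
have L2 : L1on 0 x (fun t => sin (s * (x - t)) ^+ 2).
  apply: (@L1on_ext _ _ _ (fun t => sin (s * (x - t)) * sin (s * (x - t)))) => //.
  by apply: L1onM => //; exact: L1on_continuous.
(* The parabola [3 / 8 + 2 / 3 * y ^ 2] touches [y] at [y = 3 / 4]. For [x <= 1] and [s >= 4] its
   integral is at most [3 / 8 + 2 / 3 * (1 / 2 + 1 / 16) = 3 / 4]. *)
apply: (@le_trans _ _ (int 0 x (fun t => 3 / 8 + 2 / 3 * sin (s * (x - t)) ^+ 2))).
  apply: int_le; first by apply: L1on_norm; exact: L1on_continuous.
    by apply: L1onD; [exact: L1on_cst|exact: L1onZ].
  move=> t _; rewrite -[_ ^+ 2]real_normK ?num_real //; set y := `|_|.
  rewrite -subr_ge0 (_ : _ - _ = 2 / 3 * (y - 3 / 4) ^+ 2); last by field.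
  by rewrite mulr_ge0 // sqr_ge0.
rewrite intD; [|exact: L1on_cst|exact: L1onZ].
rewrite int_cst // subr0 intZ //.
have := int_sin2_le s0 x01.
have : (4 * s)^-1 <= 1 / 16.
  by rewrite -[_^-1]mul1r ler_pdivrMr ?mulr_gt0 //; lra.
lra.
Qed.

(** Mean value theorem from [N 0 = 0]. The first source [N (u_0)] must be estimated proportionally
    to [u_0] to keep the factor [kap]; this explains the term [Nbar' (v 0) * v 0] in [v 1]. *)
Lemma norm_le_derive_majorant (N Nbar : R -> R) (M y : R) :
  (forall x : R, derivable N x 1) -> N 0 = 0 ->
  (forall u, `|derive1n 1 N u| <= derive1n 1 Nbar `|u|) ->
  (forall x, 0 <= x <= M -> derive1n 1 Nbar x <= derive1n 1 Nbar M) ->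
  `|y| <= M -> `|N y| <= derive1n 1 Nbar M * `|y|.
Proof.
move=> dN N0 hN mono yM.
have hd (x : R) : is_derive x 1 N (derive1n 1 N x).
  by rewrite /= derive1E; apply: DeriveDef.
have cN : continuous N.
  by move=> x; apply: differentiable_continuous; apply/derivable1_diffP.
have key a b z : a <= b -> z \in `[a, b] -> (forall t, a <= t <= b -> `|t| <= `|y|) ->
    `|derive1n 1 N z| <= derive1n 1 Nbar M.
  move=> ab; rewrite in_itv /= => zab h; apply: (le_trans (hN z)); apply: mono.
  by rewrite normr_ge0 (le_trans (h z zab)).
have [y0|y0] := leP 0 y.
  have [z zy] := @MVT_segment _ N _ 0 y y0 (fun x _ => hd x) (continuous_subspaceT cN).
  rewrite N0 !subr0 => ->; rewrite normrM ler_wpM2r //; apply: key zy _ => // t /andP[t0 ty].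
  by rewrite !ger0_norm.
have [z zy] := @MVT_segment _ N _ y 0 (ltW y0) (fun x _ => hd x) (continuous_subspaceT cN).
rewrite N0 !sub0r => /(congr1 -%R); rewrite opprK mulrN opprK => ->.
rewrite normrM ler_wpM2r //; apply: key zy _; first exact: ltW.
by move=> t /andP[t0 ty]; rewrite !ler0_norm ?lerN2 // ltW.
Qed.

End Iteration.

Section Corrections.
Context {R : realType}.
Local Notation leb := (@lebesgue_measure R).
Local Notation int a b f := (\int[leb]_(t in `[a, b]%classic) f t).
Context (q N Nbar : R -> R) (v : nat -> R).
Local Notation qn := (int 0 1 (fun x => `|q x|)).
Hypothesis L1q : L1on 0 1 q.
Hypothesis derN : forall x : R, derivable N x 1.
Hypothesis N_0 : N 0 = 0.
Hypothesis N_le : forall k (u : R), `|derive1n k N u| <= derive1n k Nbar `|u|.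
Hypothesis Nbar_mono : forall k (x y : R), 0 <= x -> x <= y ->
  derive1n k Nbar x <= derive1n k Nbar y.
Hypothesis maj_v : majorant qn Nbar v.

Lemma Nbar_ge0 k (x : R) : 0 <= x -> 0 <= derive1n k Nbar x.
Proof. by move=> x0; rewrite -(ger0_norm x0); apply: le_trans (N_le k x). Qed.

Let q0 : 0 <= qn. Proof. exact: int_ge0. Qed.
Let v_ge0 : forall j, 0 <= v j := majorant_ge0 q0 Nbar_ge0 maj_v.
Let nl_ge0 : forall j, 0 <= nonlin_term Nbar v j := nonlin_term_ge0 q0 Nbar_ge0 maj_v.

Lemma conv_sumE j : conv_sum v j = \sum_(p < j) v (j - p)%N * v p.+1.
Proof. by rewrite /conv_sum big_add1 /= big_mkord. Qed.

Lemma conv_sum_ge0 j : 0 <= conv_sum v j.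
Proof. by rewrite conv_sumE; apply: sumr_ge0 => i _; exact: mulr_ge0. Qed.

Lemma majorantS_ge j :
  conv_sum v j + 11 / 3 * (qn * v j + nonlin_term Nbar v j) = v j.+1.
Proof. by rewrite (majorantS _ maj_v) maj_v.1; congr (_ + _ * _); field. Qed.

(** [kap] is the size of the coefficient of [lam j.+1] in the solvability condition and also the
    scale of the bounds on the functions. Here [om] bounds the response to the trial function; the
    damping ratio that bears this name in other sections enters only through [k]. *)
Context (s kap om k : R) (lam : nat -> R) (w dw : nat -> R -> R).
Hypothesis s_ge4 : 4 <= s.
Hypothesis kap_gt0 : 0 < kap.
Hypothesis kap_le : kap <= 2 / 3.
Hypothesis k_gt0 : 0 < k.
Hypothesis w0_L1 : L1on 0 1 (w 0%N).
(* [4 * kap = 3 / 2 * kap * v 0]: for odd [n] in part (b) the trial function is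
   not bounded by [kap * v 0]. The resulting factor [3 / 2] in the estimates below
   is absorbed by [3 / 4 * (1 + v 0) = 11 / 4]. *)
Hypothesis w0_le : forall x, 0 <= x <= 1 -> `|w 0%N x| <= 4 * kap.
Hypothesis solvability : `|int 0 1 (fun t => sin (s * (1 - t)) * w 0%N t)| = kap.
Hypothesis response_le : forall x, 0 <= x <= 1 ->
  `|int 0 x (fun t => sin (s * (x - t)) * w 0%N t)| <= om.
(** The condition that closes the induction for [w j.+1]: the source contributes [3 / 4 * kap], the
    term with [lam j.+1] contributes [3 / 4 * om], and solving the equation divides by [s]. *)
Hypothesis k_large : 3 / 4 * (om + kap) <= s * kap * k.
Hypothesis w_sol : forall j, ode_sol 0 1
  (fun x => FDrhs q N lam w j x - s ^+ 2 * w j.+1 x) (w j.+1) (dw j.+1).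
Hypothesis w_at0 : forall j, w j.+1 0 = 0.
Hypothesis w_at1 : forall j, w j.+1 1 = 0.
Hypothesis dw_at0 : forall j, dw j.+1 0 = 0.

Definition correction_bound j := `|lam j.+1| <= k ^+ j * v j.+1 /\
  forall x, 0 <= x <= 1 -> `|w j.+1 x| <= kap * k ^+ j.+1 * v j.+1.

Lemma iterate_le j : (forall i, (i < j)%N -> correction_bound i) ->
  forall x, 0 <= x <= 1 -> `|w j x| <= 3 / 2 * kap * k ^+ j * v j.
Proof.
case: j => [_|j IH] x x01.
  rewrite maj_v.1 expr0; apply: (le_trans (w0_le x01)); lra.
apply: (le_trans ((IH j (ltnSn _)).2 x x01)).
have : 0 <= kap * k ^+ j.+1 * v j.+1 by rewrite !mulr_ge0 ?exprn_ge0 // ltW.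
by rewrite -!mulrA; set y := kap * _; lra.
Qed.

Lemma adomian_correction_le j : (forall i, (i < j)%N -> correction_bound i) ->
  forall x, 0 <= x <= 1 ->
  `|adomian (fun k => derive1n k N) j (fun p => w p x)|
  <= 3 / 2 * kap * k ^+ j * nonlin_term Nbar v j.
Proof.
move=> IH x x01; have w0v : `|w 0%N x| <= v 0%N.
  by rewrite maj_v.1; apply: (le_trans (w0_le x01)); move: kap_le; lra.
case: j IH => [_|j IH].
  have m1 x0 : 0 <= x0 <= v 0%N -> derive1n 1 Nbar x0 <= derive1n 1 Nbar (v 0%N).
    by move=> /andP[y0 yv]; exact: (Nbar_mono 1).
  rewrite adomian0; apply: (le_trans (norm_le_derive_majorant derN N_0 (N_le 1) m1 w0v)).
  rewrite /nonlin_term mulrCA; apply: ler_wpM2l; first exact: (Nbar_ge0 1).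
  rewrite maj_v.1 expr0; apply: (le_trans (w0_le x01)); lra.
have B : `|adomian (fun k => derive1n k N) j.+1 (fun p => w p x)|
    <= kap * k ^+ j.+1 * nonlin_term Nbar v j.+1.
  apply: adomian_le => //.
  - by apply/andP; split; move: kap_le kap_gt0; lra.
  - exact: ltW.
  - by move=> i; apply: (le_trans (N_le i _)); exact: Nbar_mono.
  - by move=> [//|i] /andP[_ ij]; exact: (IH i ij).2.
apply: (le_trans B).
have : 0 <= kap * k ^+ j.+1 * nonlin_term Nbar v j.+1 by rewrite !mulr_ge0 ?exprn_ge0 // ltW.
by rewrite -!mulrA; set y := kap * _; lra.
Qed.

(** The term [p = 0] contains the still unknown [lam j.+1] and is moved to the left. In every other
    one, [k ^ (j - p)] for [lam (j + 1 - p)] and [k ^ p] for [w p] multiply to [k ^ j]: hence one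
    power of [k] less in the bound for the eigenvalues. *)
Lemma FDrhs_le j : (forall i, (i < j)%N -> correction_bound i) ->
  forall x, 0 <= x <= 1 ->
  `|FDrhs q N lam w j x + lam j.+1 * w 0%N x| <=
    kap * k ^+ j * conv_sum v j + 3 / 2 * kap * k ^+ j * v j * `|q x|
    + 3 / 2 * kap * k ^+ j * nonlin_term Nbar v j.
Proof.
move=> IH x x01.
rewrite /FDrhs big_ord_recl /= subn0 opprD.
set A := adomian _ _ _; set S := \sum_(i < j) _.
have -> : - (lam j.+1 * w 0%N x) - S + q x * w j x + A + lam j.+1 * w 0%N x
   = - S + q x * w j x + A by ring.
apply: (le_trans (ler_normD _ _)); apply: lerD; last exact: adomian_correction_le.
apply: (le_trans (ler_normD _ _)); apply: lerD.
  rewrite normrN conv_sumE mulr_sumr; apply: (le_trans (ler_norm_sum _ _ _)).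
  apply: ler_sum => i _; rewrite /bump /= add1n subSS normrM.
  have ij := ltn_ord i.
  have [l1 _] : correction_bound (j - i.+1) by apply: IH; rewrite ltn_subrL (leq_ltn_trans _ ij).
  have [_ /(_ x x01) l2] := IH i ij.
  rewrite -subSn // subSS in l1.
  apply: (le_trans (ler_pM _ _ l1 l2)) => //.
  have -> : k ^+ j = k ^+ (j - i.+1) * k ^+ i.+1 by rewrite -exprD subnK.
  by rewrite le_eqVlt; apply/orP; left; apply/eqP; ring.
by rewrite normrM mulrC ler_wpM2r // iterate_le.
Qed.

(** With [G] the source freed of [lam j.+1 * w 0], the condition [w j.+1 1 = 0] equates the integral
    of [G] at [x = 1] with [lam j.+1] times an integral of modulus [kap]; dividing by [kap] bounds
    [lam j.+1]. The formula at general [x] then bounds [w j.+1]. *)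
Lemma correction_boundP j : correction_bound j.
Proof.
elim/ltn_ind: j => j IH.
have s0 : 0 < s by apply: lt_le_trans s_ge4.
have kj0 : 0 <= k ^+ j by rewrite exprn_ge0 // ltW.
pose F := FDrhs q N lam w j; pose G t := F t + lam j.+1 * w 0%N t.
have VC := variation_of_constants (w_sol j) (w_at0 j) (dw_at0 j).
have sub (f : R -> R) (x : R) : 0 <= x <= 1 -> L1on 0 1 f -> L1on 0 x f.
  by move=> /andP[_ x1]; exact: L1on_sub.
have one : 0 <= (1 : R) <= 1 by rewrite ler01 lexx.
have L1F : L1on 0 1 F by have [] := VC 1 one.
have L1G : L1on 0 1 G by apply: L1onD => //; exact: L1onZ.
have cs x : continuous (fun t => sin (s * (x - t))).
  rewrite (_ : (fun t => _) = (fun t => sin (s * x + (- s) * t))).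
    exact: continuous_sin_affine.
  by apply/funext => t; congr sin; ring.
(* The convolution part takes the factor 3/4 from the integral of the sine. The other two parts use
   [|sin| <= 1] and carry 3/2, which fits since their allowance is [3 / 4 * (11 / 3) = 11 / 4]. *)
have intG x : 0 <= x <= 1 ->
    `|int 0 x (fun t => sin (s * (x - t)) * G t)| <= 3 / 4 * (kap * k ^+ j * v j.+1).
  move=> x01; have [x0 x1] := andP x01.
  pose c1 := kap * k ^+ j * conv_sum v j.
  pose c2 := 3 / 2 * kap * k ^+ j * v j.
  pose c3 := 3 / 2 * kap * k ^+ j * nonlin_term Nbar v j.
  have c10 : 0 <= c1 by rewrite /c1 !mulr_ge0 ?conv_sum_ge0 // ltW.
  have c20 : 0 <= c2 by rewrite /c2 !mulr_ge0 // ltW.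
  have c30 : 0 <= c3 by rewrite /c3 !mulr_ge0 // ltW.
  have Ls : L1on 0 x (fun t => `|sin (s * (x - t))|) by apply: L1on_norm; exact: L1on_continuous.
  have Lq : L1on 0 x (fun t => `|q t|) by apply: L1on_norm; exact: sub.
  apply: (@le_trans _ _ (int 0 x (fun t => c1 * `|sin (s * (x - t))| + c2 * `|q t| + c3))).
    apply: int_norm_le.
    - by apply: L1onM => //; exact: sub.
    - by apply: L1onD; [apply: L1onD; exact: L1onZ|exact: L1on_cst].
    move=> t /andP[t0 tx]; have t01 : 0 <= t <= 1 by rewrite t0 (le_trans tx).
    have S1 : `|sin (s * (x - t))| <= 1 by rewrite ler_norml sin_geN1 sin_le1.
    have := FDrhs_le IH t01; rewrite -/F -/(G t) -/c1 -/c2 -/c3 normrM => h.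
    apply: (le_trans (ler_wpM2l (normr_ge0 _) h)).
    set y := `|sin _| in S1 *; set z := `|q t|.
    have z0 : 0 <= z by exact: normr_ge0.
    rewrite !mulrDr [y * c1]mulrC; apply: lerD; first apply: lerD => //.
      by rewrite ler_piMl // mulr_ge0.
    by rewrite ler_piMl.
  rewrite intD; [|by apply: L1onD; exact: L1onZ|exact: L1on_cst].
  rewrite intD; [|exact: L1onZ|exact: L1onZ].
  rewrite intZ // (intZ c2) // int_cst // subr0.
  have h1 : c1 * int 0 x (fun t => `|sin (s * (x - t))|) <= c1 * (3 / 4).
    by apply: ler_wpM2l => //; exact: int_abs_sin_le.
  have h2 : c2 * int 0 x (fun t => `|q t|) <= c2 * qn.
    apply: ler_wpM2l => //; rewrite [X in _ <= X](int_split x0 x1); last exact: L1on_norm.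
    by rewrite lerDl int_ge0.
  have h3 : c3 * x <= c3 by rewrite ler_piMr.
  apply: (le_trans (lerD (lerD h1 h2) h3)); rewrite -majorantS_ge /c1 /c2 /c3.
  set P := kap * k ^+ j.
  have -> : 3 / 2 * kap * k ^+ j * v j * qn = 3 / 2 * (P * (qn * v j)) by rewrite /P; ring.
  have -> : 3 / 2 * kap * k ^+ j * nonlin_term Nbar v j = 3 / 2 * (P * nonlin_term Nbar v j).
    by rewrite /P; ring.
  have P0 : 0 <= P by rewrite mulr_ge0 // ltW.
  rewrite mulrDr [P * (11 / 3 * _)]mulrCA mulrDr.
  have : 0 <= P * (qn * v j) by apply: mulr_ge0 => //; exact: mulr_ge0.
  have : 0 <= P * nonlin_term Nbar v j by rewrite mulr_ge0.
  lra.
have split_int x : 0 <= x <= 1 -> s * w j.+1 x =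
   int 0 x (fun t => sin (s * (x - t)) * G t)
   - lam j.+1 * int 0 x (fun t => sin (s * (x - t)) * w 0%N t).
  move=> x01; have [_ ->] := VC x x01.
  rewrite -intZ; last by apply: L1onM => //; exact: sub.
  rewrite -intB; last 2 first.
  - by apply: L1onM => //; exact: sub.
  - by apply: L1onZ; apply: L1onM => //; exact: sub.
  by apply: int_ext => t _; rewrite /G /F; ring.
have lamb : `|lam j.+1| <= 3 / 4 * (k ^+ j * v j.+1).
  have := split_int 1 one; rewrite w_at1 mulr0 => /esym/eqP; rewrite subr_eq0 => /eqP e.
  have := intG 1 one; rewrite e normrM solvability [`|_| * kap]mulrC.
  rewrite [X in _ <= X](_ : _ = kap * (3 / 4 * (k ^+ j * v j.+1))); last by ring.
  by rewrite ler_pM2l.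
have kv0 : 0 <= k ^+ j * v j.+1 by rewrite mulr_ge0.
split; first by apply: (le_trans lamb); lra.
move=> x x01; rewrite -(ler_pM2l s0).
rewrite -[X in X * _](ger0_norm (ltW s0)) -normrM split_int //.
apply: (le_trans (ler_normB _ _)); rewrite normrM.
have h2 : `|lam j.+1| * `|int 0 x (fun t => sin (s * (x - t)) * w 0%N t)|
   <= 3 / 4 * (k ^+ j * v j.+1) * om by apply: ler_pM => //; exact: response_le.
apply: (le_trans (lerD (intG x x01) h2)).
rewrite [X in X <= _](_ : _ = (3 / 4 * (om + kap)) * (k ^+ j * v j.+1)); last by ring.
rewrite [X in _ <= X](_ : _ = (s * kap * k) * (k ^+ j * v j.+1)); last by rewrite exprS; ring.
exact: ler_wpM2r.
Qed.

Lemma conv_sum_le j : conv_sum v j <= v j.+1.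
Proof.
by rewrite -majorantS_ge lerDl mulr_ge0 // addr_ge0 // mulr_ge0.
Qed.

Lemma nonlin_term_le j : nonlin_term Nbar v j <= v j.+1.
Proof.
rewrite -majorantS_ge.
have := conv_sum_ge0 j; have := nl_ge0 j; have : 0 <= qn * v j by exact: mulr_ge0.
move: (conv_sum v j) (nonlin_term Nbar v j) (qn * v j) => x y z; lra.
Qed.

(** The constant [13 / 2] is [1 + 3 / 2 + 4]: convolution, nonlinear term, and the restored
    [lam j.+1 * w 0]. The estimate supplies the dominating function for the limit. *)
Lemma FDrhs_norm_le j x : 0 <= x <= 1 -> `|FDrhs q N lam w j x| <=
  13 / 2 * kap * (k ^+ j * v j.+1) + 3 / 2 * kap * (k ^+ j * v j) * `|q x|.
Proof.
move=> x01; have B := FDrhs_le (fun i (_ : (i < j)%N) => correction_boundP i) x01.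
have B2 : `|lam j.+1 * w 0%N x| <= k ^+ j * v j.+1 * (4 * kap).
  rewrite normrM; apply: ler_pM => //; last exact: w0_le.
  exact: (correction_boundP j).1.
rewrite -[FDrhs _ _ _ _ _ _](addrK (lam j.+1 * w 0%N x)).
apply: (le_trans (ler_normB _ _)); apply: (le_trans (lerD B B2)).
have kk0 : 0 <= kap * k ^+ j by rewrite mulr_ge0 ?exprn_ge0 // ltW.
have c1 := ler_wpM2l kk0 (conv_sum_le j).
have c2 := ler_wpM2l kk0 (nonlin_term_le j).
rewrite -subr_ge0.
rewrite (_ : _ - _ = (kap * k ^+ j * v j.+1 - kap * k ^+ j * conv_sum v j)
  + 3 / 2 * (kap * k ^+ j * v j.+1 - kap * k ^+ j * nonlin_term Nbar v j)); last by field.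
by rewrite addr_ge0 ?mulr_ge0 ?subr_ge0.
Qed.

End Corrections.

(** * Convergence of the method *)

Section Convergence.
Context {R : realType}.
Local Notation leb := (@lebesgue_measure R).
Local Notation int a b f := (\int[leb]_(t in `[a, b]%classic) f t).

(** Decay with ratio [om ^ 2] leaves room for the growing weight [om^-1]: the product still decays
    like [om ^ p]. *)
Lemma weighted_sum_le (x : nat -> R) (A om : R) : 0 < om < 1 -> 0 <= A ->
  (forall j, `|x j| <= A * (om ^+ 2) ^+ j) ->
  forall M, \sum_(p < M) `|x p| * om^-1 ^+ p <= A / (1 - om).
Proof.
move=> /andP[om0 om1] A0 xA M.
apply: (@le_trans _ _ (A * \sum_(p < M) om ^+ p)); last first.
  by rewrite ler_wpM2l // sum_geometric_le // om1 ltW.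
rewrite mulr_sumr; apply: ler_sum => p _.
apply: (@le_trans _ _ (A * (om ^+ 2) ^+ p * om^-1 ^+ p)).
  by rewrite ler_wpM2r // exprn_ge0 // invr_ge0 ltW.
by rewrite -mulrA -exprMn expr2 -mulrA divff ?mulr1 // gt_eqF.
Qed.

Lemma cvg_geometric_sum (x : nat -> R) (A om : R) : 0 < om < 1 ->
  (forall j, `|x j| <= A * (om ^+ 2) ^+ j) ->
  (fun m => \sum_(j < m) x j) @ \oo --> limn (series x).
Proof.
move=> /andP[om0 om1] xA; rewrite sum_seriesE.
apply: (@is_cvg_series_geometric_bound _ _ A (om ^+ 2)) => //.
by rewrite exprn_ge0 ?(ltW om0) // exprn_ilt1 // ltW.
Qed.

Context (q : R -> R) (c lam : nat -> R) (uu duu : nat -> R -> R) (du0 h : R -> R).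
Context (a b s om A1 A2 d : R).
Local Notation N := (entire_fun c).
Hypothesis entire_c : entire c.
Hypothesis om01 : 0 < om < 1.
Hypothesis A1_ge0 : 0 <= A1.
Hypothesis A2_ge0 : 0 <= A2.
Hypothesis lam0E : lam 0%N = s ^+ 2.
Hypothesis sol0 : ode_sol a b (fun x => - s ^+ 2 * uu 0%N x) (uu 0%N) du0.
Hypothesis solS : forall j, ode_sol a b
  (fun x => FDrhs q N lam uu j x - s ^+ 2 * uu j.+1 x) (uu j.+1) (duu j.+1).
Hypothesis lam_le : forall j, `|lam j.+1| <= A2 * (om ^+ 2) ^+ j.
Hypothesis uu_le : forall j x, a <= x <= b -> `|uu j x| <= A1 * (om ^+ 2) ^+ j.
Hypothesis L1h : L1on a b h.
Hypothesis rhs_le : forall j x, a <= x <= b -> `|FDrhs q N lam uu j x| <= h x * om ^+ j.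

Definition sum_du (m : nat) (x : R) : R := du0 x + \sum_(j < m) duu j.+1 x.
Hypothesis du_a : sum_du ^~ a @ \oo --> d.

Definition lam_sum := lam 0%N + limn (series (fun j => lam j.+1)).
Definition u_sum x := limn (series (fun j => uu j x)).

Lemma cvg_lam_sum : (fun m => \sum_(j < m.+1) lam j) @ \oo --> lam_sum.
Proof.
rewrite (_ : (fun m => _) = (fun m => lam 0%N + \sum_(j < m) lam j.+1)); last first.
  by apply/funext => m; rewrite big_ord_recl.
by apply: cvgD; [exact: cvg_cst|exact: cvg_geometric_sum lam_le].
Qed.

Lemma cvg_u_sum x : a <= x <= b -> (fun m => \sum_(j < m) uu j x) @ \oo --> u_sum x.
Proof. by move=> xab; apply: (@cvg_geometric_sum _ A1 om) => // j; exact: uu_le. Qed.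

(** Only the [lam] of positive index occur in the sources, so the Cauchy product yields the limit
    eigenvalue without [lam 0]; that part is restored by the term [s ^ 2 * u] of the equation. *)
Lemma cvg_FDrhs_sum x : a <= x <= b ->
  (fun m => \sum_(j < m) FDrhs q N lam uu j x) @ \oo -->
    - (u_sum x * limn (series (fun j => lam j.+1))) + q x * u_sum x + N (u_sum x).
Proof.
move=> xab; have [om0 om1] := andP om01.
have rho1 : 1 < om^-1 by rewrite invf_gt1.
rewrite (_ : (fun m => _) = (fun m =>
   - (\sum_(j < m) \sum_(p < j.+1) uu p x * lam (j - p).+1)
   + q x * (\sum_(j < m) uu j x)
   + \sum_(j < m) adomian (fun k => derive1n k N) j (fun p => uu p x))); last first.
  apply/funext => m; rewrite -sumrN mulr_sumr -!big_split /=; apply: eq_bigr => j _.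
  rewrite /FDrhs; congr (- _ + _ + _); apply: eq_bigr => p _.
  by rewrite mulrC subSn // -ltnS.
have uu_x j : `|uu j x| <= A1 * (om ^+ 2) ^+ j by exact: uu_le.
apply: cvgD; first apply: cvgD.
- apply: cvgN; apply: (@cvg_cauchy_product _ (fun p => uu p x) (fun p => lam p.+1) (om^-1)
    (A1 / (1 - om)) (A2 / (1 - om))) => //.
  + exact: (weighted_sum_le om01 A1_ge0 uu_x).
  + exact: (weighted_sum_le om01 A2_ge0 lam_le).
  + exact: cvg_u_sum.
  + exact: cvg_geometric_sum lam_le.
- by apply: cvgMl_tmp; exact: cvg_u_sum.
- apply: (@sum_adomian _ c _ om^-1 (A1 / (1 - om))) => //.
  + exact: (weighted_sum_le om01 A1_ge0 uu_x).
  + exact: cvg_u_sum.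
Qed.

Lemma FD_limit : exists du, ode_sol a b (fun x => (q x - lam_sum) * u_sum x + N (u_sum x)) u_sum du
  /\ du a = d /\ forall x, a <= x <= b -> sum_du ^~ x @ \oo --> du x.
Proof.
have [om0 om1] := andP om01.
(* Sum of the first equations: [m + 1] functions but only [m] sources, the trial function having
   none. *)
pose U m x := \sum_(j < m.+1) uu j x.
pose G m x := \sum_(j < m) FDrhs q N lam uu j x - s ^+ 2 * U m x.
have solm m : ode_sol a b (G m) (U m) (sum_du m).
  elim: m => [|m IH].
    apply: ode_sol_ext sol0 => x _; rewrite /G /U /sum_du ?big_ord_recl ?big_ord0 ?addr0 //.
    by rewrite add0r mulNr.
  apply: ode_sol_ext (ode_solD IH (solS m)) => x _.
  - by rewrite /G /U [X in _ = X - _]big_ord_recr [X in _ = _ - _ * X]big_ord_recr /=; ring.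
  - by rewrite /U [in RHS]big_ord_recr.
  - by rewrite /sum_du [in RHS]big_ord_recr /= addrA.
pose H x := h x * (1 - om)^-1 + s ^+ 2 * (A1 * (1 - om ^+ 2)^-1).
have om21 : 0 <= om ^+ 2 < 1 by rewrite exprn_ge0 ?(ltW om0) // exprn_ilt1 // ltW.
have L1H : L1on a b H.
  apply: L1onD; last exact: L1on_cst.
  by apply: (L1on_ext _ (L1onZ (1 - om)^-1 L1h)) => x _; rewrite mulrC.
have cvgU x : a <= x <= b -> U ^~ x @ \oo --> u_sum x.
  by move=> xab; have := cvg_u_sum xab; rewrite -cvg_shiftS.
have cvgG x : a <= x <= b -> G ^~ x @ \oo --> (q x - lam_sum) * u_sum x + N (u_sum x).
  move=> xab; set L := limn (series (fun j => lam j.+1)).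
  rewrite [X in _ --> X](_ : _ =
    - (u_sum x * L) + q x * u_sum x + N (u_sum x) - s ^+ 2 * u_sum x); last first.
    by rewrite /lam_sum lam0E -/L; ring.
  by apply: cvgB; [exact: cvg_FDrhs_sum|apply: cvgMl_tmp; exact: cvgU].
have G_le m x : a <= x <= b -> `|G m x| <= H x.
  move=> xab; apply: (le_trans (ler_normB _ _)); apply: lerD.
    apply: (le_trans (ler_norm_sum _ _ _)).
    have h0 : 0 <= h x by have := rhs_le 0 xab; rewrite expr0 mulr1; exact: le_trans.
    apply: (@le_trans _ _ (h x * \sum_(j < m) om ^+ j)).
      by rewrite mulr_sumr; apply: ler_sum => j _; exact: rhs_le.
    by rewrite ler_wpM2l // sum_geometric_le // om1 ltW.
  rewrite normrM normrX real_normK ?num_real //; apply: ler_wpM2l; first exact: sqr_ge0.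
  apply: (le_trans (ler_norm_sum _ _ _)).
  apply: (@le_trans _ _ (A1 * \sum_(j < m.+1) (om ^+ 2) ^+ j)).
    by rewrite mulr_sumr; apply: ler_sum => j _; exact: uu_le.
  by rewrite ler_wpM2l // sum_geometric_le.
have [sol cvgdu] := ode_sol_limit solm L1H cvgU du_a cvgG G_le.
exists (fun x => d + int a x (fun x => (q x - lam_sum) * u_sum x + N (u_sum x))).
by split => //; split => //; rewrite int_point addr0.
Qed.

End Convergence.

(** * The convergence theorem common to both families of trial pairs *)

Section Assembly.
Context {R : realType}.
Local Notation leb := (@lebesgue_measure R).
Local Notation int a b f := (\int[leb]_(t in `[a, b]%classic) f t).

Lemma power_series_entire (a : nat -> R) (N : R -> R) :
  (forall u : R, (fun n => \sum_(i < n) a i.+1 * u ^+ i.+1) @ \oo --> N u) ->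
  exists c, [/\ entire c, N = entire_fun c & N 0 = 0].
Proof.
move=> hN; pose c i := if i is 0 then 0 else a i.
have cN u : pseries c u @ \oo --> N u.
  rewrite -cvg_shiftS; apply: cvg_trans (hN u); apply: near_eq_cvg; apply: nearW => n.
  by rewrite /pseries /series /= big_mkord big_ord_recl /= mul0r add0r.
exists c; split.
- by move=> x; apply/cvg_ex; exists (N x).
- by apply/funext => x; apply/esym; apply: cvg_lim => //; exact: cN.
- apply: (cvg_unique _ (hN 0)) => //.
  have E n : 0 = \sum_(i < n) a i.+1 * 0 ^+ i.+1 :> R.
    by apply/esym/big1 => i _; rewrite expr0n mulr0.
  by rewrite -(funext E); exact: cvg_cst.
Qed.

Lemma derive1n_mono (Nbar : R -> R) :
  (forall k (x : R), derivable (derive1n k Nbar) x 1) ->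
  (forall k (x : R), 0 <= x -> 0 <= derive1n k Nbar x) ->
  forall k (x y : R), 0 <= x -> x <= y -> derive1n k Nbar x <= derive1n k Nbar y.
Proof.
move=> dN N0 k x y x0 xy.
have hd (t : R) : is_derive t 1 (derive1n k Nbar) (derive1n k.+1 Nbar t).
  by rewrite derive1nS derive1E; apply: DeriveDef.
have cN : continuous (derive1n k Nbar).
  by move=> t; apply: differentiable_continuous; apply/derivable1_diffP.
have [z zxy E] := @MVT_segment _ _ _ x y xy (fun t _ => hd t) (continuous_subspaceT cN).
rewrite -subr_ge0 E mulr_ge0 ?subr_ge0 // N0 //.
by move: zxy; rewrite in_itv /= => /andP[xz _]; exact: le_trans xz.
Qed.

Lemma rate_bounds v (K : R) : 0 < K -> (K%:E < conv_radius v)%E ->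
  0 <= K * invR (conv_radius v) < 1.
Proof.
move=> K0; case: (conv_radius v) => [r| |] //=; last by rewrite mulr0 lexx ltr01.
rewrite lte_fin => Kr; have r0 := lt_trans K0 Kr.
by rewrite mulr_ge0 ?invr_ge0 ?(ltW K0) ?(ltW r0) //= ltr_pdivrMr // mul1r.
Qed.

Lemma FDrhs_ext (q N : R -> R) lam (u u' : nat -> R -> R) j x :
  (forall p, u p x = u' p x) -> FDrhs q N lam u j x = FDrhs q N lam u' j x.
Proof.
move=> uu; have E : (fun p => u p x) = (fun p => u' p x) by apply/funext.
rewrite /FDrhs E uu; congr (- _ + _ + _).
by apply: eq_bigr => p _; rewrite uu.
Qed.

(** In all cases of the statement the factor in the bound for the functions is the solvability
    integral [kap]: [3 / (8 s)] in (a), and in (b), where [s = 2 pi n], [3 / (4 s)] or [1 / (4 s)]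
    by the parity of [n]. Hence the form required of [bu]. *)
Lemma FD_method_converges (q : R -> R) (a : nat -> R) (N Nbar : R -> R) (v : nat -> R)
    (s kap omr om K : R) (u10 u20 du10 du20 : R -> R)
    (lam : nat -> R) (u1 u2 du1 du2 : nat -> R -> R) (bu : R -> R -> nat -> R) :
  L1on 0 1 q ->
  (forall u : R, (fun n => \sum_(i < n) a i.+1 * u ^+ i.+1) @ \oo --> N u) ->
  (forall (k : nat) (x : R), derivable (derive1n k Nbar) x 1) ->
  (forall (k : nat) (u : R), `|derive1n k N u| <= derive1n k Nbar `|u|) ->
  majorant (int 0 1 (fun x => `|q x|)) Nbar v ->
  4 <= s -> 0 < kap -> kap <= 2 / 3 -> 0 < om < 1 -> 0 < K ->
  3 / 4 * (omr + kap) <= s * kap * (om ^+ 2 * K) ->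
  (forall x : R, is_derive x 1 u10 (du10 x)) ->
  (forall x : R, is_derive x 1 du10 (- s ^+ 2 * u10 x)) ->
  (forall x : R, is_derive x 1 u20 (du20 x)) ->
  (forall x : R, is_derive x 1 du20 (- s ^+ 2 * u20 x)) ->
  u10 0 = 0 -> u20 1 = 0 -> du10 0 = 1 -> u20 (1 / 2) = u10 (1 / 2) ->
  du20 (1 / 2) - du10 (1 / 2) = 1 ->
  (forall x, 0 <= x <= 1 -> `|glue (1 / 2) u10 u20 x| <= 4 * kap) ->
  `|int 0 1 (fun t => sin (s * (1 - t)) * glue (1 / 2) u10 u20 t)| = kap ->
  (forall x, 0 <= x <= 1 ->
    `|int 0 x (fun t => sin (s * (x - t)) * glue (1 / 2) u10 u20 t)| <= omr) ->
  (K%:E < conv_radius v)%E ->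
  let rn := K * invR (conv_radius v) in
  FD_seq q N (s ^+ 2) u10 u20 lam u1 u2 du1 du2 ->
  (forall C eps m, bu C eps m = kap * (C / powR (m.+1)%:R (1 + eps)) * rn ^+ m.+1) ->
  FD_conclusion q N rn lam u1 u2
    (fun C eps m => C / (powR (m.+1)%:R (1 + eps)) * invR (conv_radius v) * rn ^+ m) bu.
Proof.
move=> L1q /power_series_entire[c [ec NE N00]] dNbar N_le maj s4 kap0 kap1 om01 K0 kbig
  du10E ddu10E du20E ddu20E u10_0 u20_1 du10_0 uhalf duhalf w0_le hD hR KR rn
  [lam0 [u1E [u2E hFD]]] buE.
have [om0 om1] := andP om01.
have half0 : 0 <= 1 / 2 :> R by lra.
have half1 : 1 / 2 <= 1 :> R by lra.
have derN (x : R) : derivable N x 1 by rewrite NE; have [] := is_derive_entire x ec.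
have Nbar0 := Nbar_ge0 N_le.
have mono := derive1n_mono dNbar Nbar0.
have q0 : 0 <= int 0 1 (fun x => `|q x|) by exact: int_ge0.
have v0 := majorant_ge0 q0 Nbar0 maj.
have vM := majorant_supermul q0 Nbar0 maj.
have continuousP (f df : R -> R) : (forall x : R, is_derive x 1 f (df x)) -> continuous f.
  by move=> hf x; apply: differentiable_continuous; apply/derivable1_diffP; have [] := hf x.
have cu10 := continuousP _ _ du10E; have cu20 := continuousP _ _ du20E.
have cZ (f : R -> R) : continuous f -> continuous (fun x => - s ^+ 2 * f x).
  by move=> cf x; apply: cvgMl_tmp; exact: cf.
pose w j := glue (1 / 2) (u1 j) (u2 j); pose dw j := glue (1 / 2) (du1 j) (du2 j).
have w0E x : 0 <= x <= 1 -> w 0%N x = glue (1 / 2) u10 u20 x.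
  move=> /andP[x0 x1]; rewrite /w /glue; case: leP => xh; first by rewrite u1E ?x0.
  by rewrite u2E // (ltW xh).
have intw0 x : 0 <= x <= 1 -> int 0 x (fun t => sin (s * (x - t)) * w 0%N t) =
    int 0 x (fun t => sin (s * (x - t)) * glue (1 / 2) u10 u20 t).
  move=> /andP[x0 x1]; apply: int_ext => t /andP[t0 tx].
  by rewrite w0E // t0 (le_trans tx).
have w1E j x : x <= 1 / 2 -> w j x = u1 j x by move=> xh; rewrite /w /glue xh.
have w2E j x : 1 / 2 <= x -> w j x = u2 j x.
  rewrite le_eqVlt => /predU1P[<-|hx]; last by rewrite /w /glue leNgt hx.
  rewrite w1E //; case: j => [|j]; last by have [_ [_ [_ [_ [_ [-> _]]]]]] := hFD j.
  by rewrite u1E ?half0 ?lexx // u2E ?half1 ?lexx // uhalf.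
pose k := om ^+ 2 * K.
have k0 : 0 < k by rewrite mulr_gt0 // exprn_gt0.
have L1w0 : L1on 0 1 (w 0%N).
  apply: (@L1on_ext _ _ _ (glue (1 / 2) u10 u20)) => [x x01|]; first by rewrite w0E.
  by apply: L1on_glue => //; exact: L1on_continuous.
have w_le0 x : 0 <= x <= 1 -> `|w 0%N x| <= 4 * kap by move=> x01; rewrite w0E // w0_le.
have one01 : 0 <= (1 : R) <= 1 by rewrite ler01 lexx.
have solv : `|int 0 1 (fun t => sin (s * (1 - t)) * w 0%N t)| = kap by rewrite intw0.
have resp x : 0 <= x <= 1 -> `|int 0 x (fun t => sin (s * (x - t)) * w 0%N t)| <= omr.
  by move=> x01; rewrite intw0 // hR.
have w_sol j : ode_sol 0 1
    (fun x => FDrhs q N lam w j x - s ^+ 2 * w j.+1 x) (w j.+1) (dw j.+1).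
  have [S1 [S2 [_ [_ [_ [e1 e2]]]]]] := hFD j.
  apply: ode_sol_ext (ode_sol_glue half0 half1 S1 S2 e1 e2) => // x _.
  rewrite {1}/glue; case: leP => xh.
    by rewrite (w1E _ _ xh) (@FDrhs_ext _ _ _ w u1) // => p; rewrite w1E.
  by rewrite (w2E _ _ (ltW xh)) (@FDrhs_ext _ _ _ w u2) // => p; rewrite w2E // ltW.
have w_at0 j : w j.+1 0 = 0 by rewrite w1E //; have [_ [_ []]] := hFD j.
have w_at1 j : w j.+1 1 = 0 by rewrite w2E //; have [_ [_ [_ []]]] := hFD j.
have dw_at0 j : dw j.+1 0 = 0.
  by rewrite /dw /glue half0; have [_ [_ [_ [_ []]]]] := hFD j.
have bound := correction_boundP L1q derN N00 N_le mono maj s4 kap0 kap1 k0 L1w0 w_le0 solv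
  resp kbig w_sol w_at0 w_at1 dw_at0.
have [r Kr [A [A0 hA]]] := conv_radius_gt KR.
(* [K] lies strictly inside the disc of convergence, so [K ^ j * v j] is bounded; the decay comes
   from [k = om ^ 2 * K]. *)
have kv j : k ^+ j * v j <= A * (om ^+ 2) ^+ j.
  rewrite /k exprMn -mulrA mulrC ler_wpM2r ?exprn_ge0 // ?(ltW om0) //.
  apply: le_trans (hA j); rewrite ger0_norm // mulrC ler_wpM2l //.
  by rewrite lerXn2r ?nnegrE ?(ltW K0) ?(ltW Kr) // (le_trans (ltW K0)) // ltW.
have om2 : 0 <= om ^+ 2 <= 1 by rewrite exprn_ge0 ?(ltW om0) //= exprn_ile1 // ltW.
have [om20 om21] := andP om2.
pose A2 := A / k.
have A20 : 0 <= A2 by rewrite divr_ge0 // ltW.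
have kvS j : k ^+ j * v j.+1 <= A2 * (om ^+ 2) ^+ j.
  rewrite /A2 mulrAC ler_pdivlMr // mulrC mulrA -exprS; apply: (le_trans (kv _)).
  by rewrite exprS mulrCA ler_piMl // mulr_ge0 // exprn_ge0.
have lam_le j : `|lam j.+1| <= A2 * (om ^+ 2) ^+ j by apply: (le_trans (bound j).1).
pose A1 := 3 / 2 * kap * A.
have A10 : 0 <= A1 by rewrite !mulr_ge0 // ltW.
have w_le j x : 0 <= x <= 1 -> `|w j x| <= A1 * (om ^+ 2) ^+ j.
  move=> x01; apply: (le_trans (iterate_le N_le maj kap0 k0 w_le0 (fun i _ => bound i) x01)).
  rewrite /A1 -[X in X <= _]mulrA -[X in _ <= X]mulrA; apply: ler_wpM2l => //.
  by rewrite mulr_ge0 // ltW.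
pose h x := 13 / 2 * kap * A2 + A1 * `|q x|.
have L1h : L1on 0 1 h by apply: L1onD; [exact: L1on_cst|apply: L1onZ; exact: L1on_norm].
have rhs_le j x : 0 <= x <= 1 -> `|FDrhs q N lam w j x| <= h x * om ^+ j.
  move=> x01.
  have B := FDrhs_norm_le L1q derN N00 N_le mono maj s4 kap0 kap1 k0 L1w0 w_le0 solv
    resp kbig w_sol w_at0 w_at1 dw_at0 j x01.
  have omj : (om ^+ 2) ^+ j <= om ^+ j.
    by rewrite -exprM mulnC exprM expr2 ler_piMl ?exprn_ge0 ?(ltW om0) // exprn_ile1 // ltW.
  have kap132 : 0 <= 13 / 2 * kap by apply: mulr_ge0 => //; exact: ltW.
  have kap32 : 0 <= 3 / 2 * kap by apply: mulr_ge0 => //; exact: ltW.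
  apply: (@le_trans _ _ (h x * (om ^+ 2) ^+ j)); last first.
    by apply: ler_wpM2l => //; rewrite /h addr_ge0 // mulr_ge0.
  apply: (le_trans B); rewrite /h [X in _ <= X]mulrDl; apply: lerD.
    by rewrite -[X in _ <= X]mulrA ler_wpM2l.
  by rewrite [X in _ <= X]mulrAC ler_wpM2r // /A1 -[X in _ <= X]mulrA ler_wpM2l.
have in1 (x : R) : 0 <= x <= 1 / 2 -> 0 <= x <= 1 by move=> /andP[-> xh] /=; exact: (le_trans xh half1).
have in2 (x : R) : 1 / 2 <= x <= 1 -> 0 <= x <= 1 by move=> /andP[hx ->]; rewrite (le_trans half0).
have sol10 : ode_sol 0 (1 / 2) (fun x => - s ^+ 2 * u1 0%N x) (u1 0%N) du10.
  apply: ode_sol_ext (ode_sol_C2 _ _ du10E ddu10E (cZ _ cu10)) => // x xh; by rewrite u1E.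
have sol20 : ode_sol (1 / 2) 1 (fun x => - s ^+ 2 * u2 0%N x) (u2 0%N) du20.
  apply: ode_sol_ext (ode_sol_C2 _ _ du20E ddu20E (cZ _ cu20)) => // x xh; by rewrite u2E.
have sol1 j := (hFD j).1; have sol2 j := (hFD j).2.1.
have u1_le j x : 0 <= x <= 1 / 2 -> `|u1 j x| <= A1 * (om ^+ 2) ^+ j.
  by move=> xh; rewrite -w1E ?w_le ?in1 //; case/andP: xh.
have u2_le j x : 1 / 2 <= x <= 1 -> `|u2 j x| <= A1 * (om ^+ 2) ^+ j.
  by move=> xh; rewrite -w2E ?w_le ?in2 //; case/andP: xh.
have rhs1 j x : 0 <= x <= 1 / 2 -> `|FDrhs q N lam u1 j x| <= h x * om ^+ j.
  move=> xh; rewrite -(@FDrhs_ext _ _ _ w) ?rhs_le ?in1 // => p.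
  by rewrite w1E //; case/andP: xh.
have rhs2 j x : 1 / 2 <= x <= 1 -> `|FDrhs q N lam u2 j x| <= h x * om ^+ j.
  move=> xh; rewrite -(@FDrhs_ext _ _ _ w) ?rhs_le ?in2 // => p.
  by rewrite w2E //; case/andP: xh.
have d1 : sum_du du1 du10 ^~ 0 @ \oo --> (1 : R).
  rewrite (_ : (fun m => _) = (fun=> 1)); first exact: cvg_cst.
  apply/funext => m; rewrite /sum_du du10_0 big1 ?addr0 // => i _.
  by have [_ [_ [_ [_ []]]]] := hFD i.
have L1h1 : L1on 0 (1 / 2) h by exact: L1on_sub L1h.
have L1h2 : L1on (1 / 2) 1 h by exact: L1on_sub L1h.
rewrite NE in sol1 sol2 rhs1 rhs2 *.
have [Du1 [E1 [Du10 cDu1]]] := FD_limit ec om01 A10 A20 lam0 sol10 sol1 lam_le u1_le L1h1 rhs1 d1.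
have hh : 0 <= (1 / 2 : R) <= 1 / 2 by rewrite half0 lexx.
(* The initial slope of the right half: the derivatives of the corrections match at [1 / 2], so the
   partial sums differ from the left ones by the jump 1 of the trial function. *)
have d2 : sum_du du2 du20 ^~ (1 / 2) @ \oo --> 1 + Du1 (1 / 2).
  rewrite (_ : (fun m => _) = (fun m => 1 + sum_du du1 du10 m (1 / 2))).
    by apply: cvgD; [exact: cvg_cst|exact: cDu1].
  apply/funext => m; rewrite /sum_du; have -> : du20 (1 / 2) = 1 + du10 (1 / 2) by apply/eqP; rewrite -subr_eq duhalf.
  rewrite -addrA; congr (_ + (_ + _)).
  by apply: eq_bigr => i _; have [_ [_ [_ [_ [_ [_ ->]]]]]] := hFD i.
have [Du2 [E2 [Du20 _]]] := FD_limit ec om01 A10 A20 lam0 sol20 sol2 lam_le u2_le L1h2 rhs2 d2.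
have cu1 x : 0 <= x <= 1 / 2 -> (fun m => \sum_(j < m) u1 j x) @ \oo --> u_sum u1 x.
  exact: (cvg_u_sum om01 u1_le).
have cu2 x : 1 / 2 <= x <= 1 -> (fun m => \sum_(j < m) u2 j x) @ \oo --> u_sum u2 x.
  exact: (cvg_u_sum om01 u2_le).
have clam := cvg_lam_sum om01 lam_le.
have zero_sum (x : nat -> R) : (forall j, x j = 0) -> limn (series x) = 0.
  move=> x0; apply: cvg_lim => //; rewrite -sum_seriesE.
  rewrite (_ : (fun n => _) = (fun=> 0)); first exact: cvg_cst.
  by apply/funext => n; apply: big1.
exists (lam_sum lam), (u_sum u1), (u_sum u2), Du1, Du2.
split.
  split => //; split => //; split.
    apply: zero_sum => -[|j]; first by rewrite u1E ?u10_0 // lexx.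
    by have [_ [_ []]] := hFD j.
  split.
    apply: zero_sum => -[|j]; first by rewrite u2E ?u20_1 // half1 lexx.
    by have [_ [_ [_ []]]] := hFD j.
  split => //; split; last by rewrite Du20 addrK.
  apply/eqP; rewrite subr_eq0; apply/eqP; congr (limn (series _)); apply/funext => j.
  by rewrite -w2E // w1E.
split => //; split.
  by move=> x /cu1; rewrite -cvg_shiftS.
split.
  by move=> x /cu2; rewrite -cvg_shiftS.
have [C C0 tail] := majorant_tail om01 v0 vM K0 KR.
(* The exponent [eps] is 1, since the tail estimate gains the square of [m + 1]. *)
exists C, 1; split => //; split => // m /=.
have /andP[rn0 rn1] := rate_bounds K0 KR.
set T := C / (1 - rn) / powR (m.+1)%:R (1 + 1) * invR (conv_radius v) * rn ^+ m.
(* The additional factor [kap * k = om ^ 2 * kap * K] turns [invR * rn ^ m] into [kap * rn ^ m.+1],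
   and [om ^ 2 <= 1] is dropped. *)
have tailu M : \sum_(i < M) (kap * k ^+ (m + i).+1 * v (m + i).+1) <= bu (C / (1 - rn)) 1 m.
  rewrite buE (_ : \sum_(i < M) _ = kap * k * \sum_(i < M) k ^+ (m + i) * v (m + i).+1); last first.
    by rewrite mulr_sumr; apply: eq_bigr => i _; rewrite exprS; ring.
  apply: (@le_trans _ _ (kap * k * T)).
    by apply: ler_wpM2l; [rewrite mulr_ge0 // ltW|exact: tail].
  rewrite /T /k [X in X <= _](_ : _ =
    om ^+ 2 * (kap * (C / (1 - rn) / powR (m.+1)%:R (1 + 1)) * rn ^+ m.+1)); last first.
    rewrite [rn ^+ m.+1]exprS; move: (C / (1 - rn) / _) (rn ^+ m) => y z.
    by rewrite /rn; ring.
  rewrite ler_piMl // mulr_ge0 ?exprn_ge0 // mulr_ge0 ?(ltW kap0) //.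
  by rewrite divr_ge0 ?powR_ge0 // divr_ge0 ?(ltW C0) // subr_ge0 ltW.
split.
  apply: (@cvg_series_tail_le _ lam (fun j => k ^+ j * v j.+1)).
  - by move=> j; exact: (bound j).1.
  - by move=> M; exact: tail.
  - by rewrite -cvg_shiftS.
split=> x xh.
  apply: (@cvg_series_tail_le _ (fun j => u1 j x) (fun j => kap * k ^+ j.+1 * v j.+1)) => //.
    by move=> j; rewrite -w1E; [apply: (bound j).2; exact: in1|case/andP: xh].
  exact: cu1.
apply: (@cvg_series_tail_le _ (fun j => u2 j x) (fun j => kap * k ^+ j.+1 * v j.+1)) => //.
  by move=> j; rewrite -w2E; [apply: (bound j).2; exact: in2|case/andP: xh].
exact: cu2.
Qed.

End Assembly.

(** * The trial eigenpairs *)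

Section Trigonometry.
Context {R : realType}.
Local Notation leb := (@lebesgue_measure R).
Local Notation int a b f := (\int[leb]_(t in `[a, b]%classic) f t).

(** For [t = pi / 3], the triple angle formula turns [cos (3 t) = -1] into
    [(cos t + 1) (2 cos t - 1) ^ 2 = 0], and [cos t > 0]. *)
Lemma cos_pi_div3 : cos (pi / 3) = 1 / 2 :> R.
Proof.
set t := pi / 3; have p0 := pi_gt0 R.
have c0 : 0 < cos t by apply: cos_gt0_pihalf; rewrite /t; apply/andP; split; lra.
have h : cos (t + (t + t)) = -1.
  by rewrite (_ : t + (t + t) = pi) ?cospi // /t; field.
have E : (cos t + 1) * (2 * cos t - 1) ^+ 2 = 0.
  have : cos (t + (t + t)) + 1 = 0 by rewrite h addNr.
  rewrite cosD cosD sinD; have -> : sin t * (sin t * cos t + cos t * sin t) = 2 * cos t * (sin t ^+ 2) by ring.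
  have -> : sin t * sin t = sin t ^+ 2 by [].
  by rewrite sin2cos2 => <-; ring.
move/eqP: E; rewrite mulf_eq0 gt_eqF ?addr_gt0 //= expf_eq0 /= => /eqP; lra.
Qed.

Lemma cos_2pi_div3 : cos (2 * pi / 3) = - (1 / 2) :> R.
Proof.
rewrite (_ : 2 * pi / 3 = pi / 3 + pi / 3); last by field.
by rewrite cosD -!expr2 sin2cos2 cos_pi_div3; field.
Qed.

Lemma sin_le_id (x : R) : 0 <= x -> sin x <= x.
Proof.
move=> x0.
have [z _] := @MVT_segment _ sin cos 0 x x0 (fun y _ => is_derive_sin y)
  (continuous_subspaceT (@continuous_sin R)).
by rewrite sin0 !subr0 => ->; rewrite ler_piMl // cos_le1.
Qed.

(** From [1 / 2 = sin (pi / 6) <= pi / 6]. *)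
Lemma pi_ge3 : 3 <= pi :> R.
Proof.
have p0 := pi_gt0 R.
have : sin (pi / 6) <= pi / 6 :> R by apply: sin_le_id; lra.
have -> : sin (pi / 6) = 1 / 2 :> R; last by lra.
by rewrite -cos_pi_div3 -cosBpihalf -cosN; congr cos; field.
Qed.

Lemma cos_natmul_pi n : cos (n%:R * pi) = (-1) ^+ n :> R.
Proof.
elim: n => [|n IH]; first by rewrite mul0r cos0.
by rewrite -natr1 mulrDl mul1r cosDpi IH exprS mulN1r.
Qed.

Lemma sin_natmul_pi n : sin (n%:R * pi) = 0 :> R.
Proof.
elim: n => [|n IH]; first by rewrite mul0r sin0.
by rewrite -natr1 mulrDl mul1r sinDpi IH oppr0.
Qed.

Lemma continuous_sin_shift (al s : R) : continuous (fun t => sin (al - s * t)).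
Proof. by under eq_fun do rewrite -mulNr; exact: continuous_sin_affine. Qed.

Lemma int_sin2_shift (s al c d : R) : 0 < s -> c <= d ->
  int c d (fun t => sin (al - s * t) ^+ 2) =
  (d - c) / 2 + (sin (2 * (al - s * d)) - sin (2 * (al - s * c))) / (4 * s).
Proof.
move=> s0 cd.
have -> : int c d (fun t => sin (al - s * t) ^+ 2) =
    - int c d (fun t => sin (al - s * t) * sin (- al + s * t)).
  rewrite -mulN1r -intZ; last first.
    apply: L1onM; first exact: continuous_sin_shift.
    by apply: L1on_continuous; exact: continuous_sin_affine.
  apply: int_ext => t _.
  by rewrite (_ : - al + s * t = - (al - s * t)) ?sinN; ring.
rewrite int_sin_sin ?gt_eqF // subrr cos0 opprK.
rewrite (_ : al + al - 2 * s * c = 2 * (al - s * c)); last by ring.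
rewrite (_ : al + al - 2 * s * d = 2 * (al - s * d)); last by ring.
by field; rewrite gt_eqF.
Qed.

Lemma int_sin2_shift_le (s al c d : R) : 0 < s -> c <= d ->
  int c d (fun t => sin (al - s * t) ^+ 2) <= (d - c) / 2 + (2 * s)^-1.
Proof.
move=> s0 cd; rewrite int_sin2_shift // lerD2l.
rewrite ler_pdivrMr ?mulr_gt0 // (_ : (2 * s)^-1 * (4 * s) = 2); last by field; rewrite gt_eqF.
have := sin_le1 (2 * (al - s * d)); have := sin_geN1 (2 * (al - s * c)); lra.
Qed.

Lemma int_mul_glue (f u1 u2 : R -> R) (x : R) : continuous f -> continuous u1 -> continuous u2 ->
  0 <= x <= 1 -> int 0 x (fun t => f t * glue (1 / 2) u1 u2 t) =
  if x <= 1 / 2 then int 0 x (fun t => f t * u1 t)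
  else int 0 (1 / 2) (fun t => f t * u1 t) + int (1 / 2) x (fun t => f t * u2 t).
Proof.
move=> cf c1 c2 /andP[x0 x1].
have E : (fun t => f t * glue (1 / 2) u1 u2 t) =
    glue (1 / 2) (fun t => f t * u1 t) (fun t => f t * u2 t).
  by apply/funext => t; rewrite /glue; case: ifP.
rewrite E; case: leP => xh; first by rewrite int_glue_left.
have cM (u : R -> R) : continuous u -> continuous (fun t => f t * u t).
  by move=> cu t; apply: cvgM; [exact: cf|exact: cu].
by rewrite (@int_glue_right _ 0 (1 / 2) x _ _ x) ?(ltW xh) //; apply: L1on_continuous; exact: cM.
Qed.

End Trigonometry.

(** * Solvability and response integrals of the trial functions *)

Section TrialFunctions.
Context {R : realType}.
Local Notation leb := (@lebesgue_measure R).
Local Notation int a b f := (\int[leb]_(t in `[a, b]%classic) f t).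
Context (s : R).
Hypothesis s_ge4 : 4 <= s.

Let s0 : 0 < s. Proof. by apply: lt_le_trans s_ge4. Qed.
Let s_neq0 : s != 0. Proof. by rewrite gt_eqF. Qed.
Let s_inv : s^-1 <= 1 / 4. Proof. by rewrite -[s^-1]mul1r ler_pdivrMr //; move: s_ge4; lra. Qed.
Let inv2s : (2 * s)^-1 <= 1 / 8. Proof. by rewrite invfM; move: s_inv; lra. Qed.
Let half01 : 0 <= 1 / 2 :> R. Proof. lra. Qed.
Let half_le1 : 1 / 2 <= 1 :> R. Proof. lra. Qed.

Lemma continuous_sin_rev x : continuous (fun t => sin (s * (x - t))).
Proof.
rewrite (_ : (fun t => _) = (fun t => sin (s * x - s * t))); first exact: continuous_sin_shift.
by apply/funext => t; rewrite mulrBr.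
Qed.

Lemma continuous_sin_mul : continuous (fun t => sin (s * t)).
Proof.
rewrite (_ : (fun t => _) = (fun t => sin (0 + s * t))); first exact: continuous_sin_affine.
by apply/funext => t; rewrite add0r.
Qed.

Lemma int_sin_sq_le c d : c <= d ->
  int c d (fun t => sin (s * t) ^+ 2) <= (d - c) / 2 + (2 * s)^-1.
Proof.
move=> cd; apply: le_trans (int_sin2_shift_le 0 s0 cd).
rewrite le_eqVlt; apply/orP; left; apply/eqP; apply: int_ext => t _.
by rewrite sub0r sinN sqrrN.
Qed.

Lemma int_sin_rev_sq_le x c d : c <= d ->
  int c d (fun t => sin (s * (x - t)) ^+ 2) <= (d - c) / 2 + (2 * s)^-1.
Proof.
move=> cd; apply: le_trans (int_sin2_shift_le (s * x) s0 cd).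
by under eq_Rintegral do rewrite mulrBr.
Qed.

Lemma L1on_sq c d (f : R -> R) : continuous f -> L1on c d (fun t => f t ^+ 2).
Proof.
move=> cf; apply: (@L1on_ext _ _ _ (fun t => f t * f t)) => //.
by apply: L1onM => //; exact: L1on_continuous.
Qed.

Lemma norm_mul_le_sq (x y : R) : `|x * y| <= 1 / 2 * (x ^+ 2 + y ^+ 2).
Proof.
rewrite normrM -[x ^+ 2]real_normK ?num_real // -[y ^+ 2]real_normK ?num_real //.
rewrite -subr_ge0 (_ : _ - _ = 1 / 2 * (`|x| - `|y|) ^+ 2); last by field.
by rewrite mulr_ge0 // sqr_ge0.
Qed.

Section CaseA.
(** This is the jump condition: the one-sided derivatives at [1 / 2] are [cos (s / 2)] and
    [- cos (s / 2)]. *)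
Hypothesis cos_half : cos (s / 2) = - (1 / 2).

Let u10 x := sin (s * x) / s.
Let u20 x := sin (s * (1 - x)) / s.

Let cu10 : continuous u10.
Proof. by move=> t; apply: cvgMr_tmp; exact: continuous_sin_mul. Qed.

Let cu20 : continuous u20.
Proof. by move=> t; apply: cvgMr_tmp; exact: continuous_sin_rev. Qed.

(** The contributions of [sin s] from the two halves cancel, and [cos s = - 1 / 2] leaves
    [1 / 8 + 1 / 4]. *)
Lemma solvability_a :
  `|int 0 1 (fun t => sin (s * (1 - t)) * glue (1 / 2) u10 u20 t)| = 3 / (8 * s).
Proof.
have coss : cos s = - (1 / 2).
  by rewrite (_ : s = s / 2 *+ 2) ?cos_mulr2n ?cos_half; field.
rewrite int_mul_glue ?ler01 ?lexx //; last exact: continuous_sin_rev.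
rewrite leNgt (_ : 1 / 2 < 1) /=; last by lra.
have -> : int 0 (1 / 2) (fun t => sin (s * (1 - t)) * u10 t) =
    s^-1 * int 0 (1 / 2) (fun t => sin (s - s * t) * sin (0 + s * t)).
  rewrite -intZ; last first.
    apply: L1onM; first exact: continuous_sin_shift.
    by apply: L1on_continuous; exact: continuous_sin_affine.
  by apply: int_ext => t _; rewrite /u10 add0r mulrBr mulr1; ring.
have -> : int (1 / 2) 1 (fun t => sin (s * (1 - t)) * u20 t) =
    s^-1 * int (1 / 2) 1 (fun t => sin (s - s * t) ^+ 2).
  rewrite -intZ; last by apply: L1on_sq; exact: continuous_sin_shift.
  by apply: int_ext => t _; rewrite /u20 mulrBr mulr1; ring.
rewrite int_sin_sin // int_sin2_shift // addr0 coss.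
rewrite (_ : s - 0 - 2 * s * 0 = s); last by ring.
rewrite (_ : s - 0 - 2 * s * (1 / 2) = 0); last by field.
rewrite (_ : 2 * (s - s * 1) = 0); last by ring.
rewrite (_ : 2 * (s - s * (1 / 2)) = s); last by field.
rewrite sin0 [X in `|X|](_ : _ = 3 / (8 * s)); last by field.
by rewrite ger0_norm // divr_ge0 // mulr_ge0 // ltW.
Qed.

(** By AM-GM, with [s >= 4], the value is at most [(9 / 16 + 3 / 4) / (2 s)]. The trivial bound
    [1 / s] would demand [s k >= 11 / 4], beyond the rate of the statement. *)
Lemma response_a x : 0 <= x <= 1 ->
  `|int 0 x (fun t => sin (s * (x - t)) * glue (1 / 2) u10 u20 t)| <= 21 / (32 * s).
Proof.
move=> x01; have [x0 x1] := andP x01.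
pose g := glue (1 / 2) (fun t => sin (s * t)) (fun t => sin (s * (1 - t))).
pose g2 := glue (1 / 2) (fun t => sin (s * t) ^+ 2) (fun t => sin (s * (1 - t)) ^+ 2).
have g2E t : g2 t = g t ^+ 2 by rewrite /g2 /g /glue; case: ifP.
have cs1 := continuous_sin_mul.
have L1a : L1on 0 (1 / 2) (fun t => sin (s * t) ^+ 2) by exact: L1on_sq.
have L1b : L1on (1 / 2) 1 (fun t => sin (s * (1 - t)) ^+ 2).
  by apply: L1on_sq; exact: continuous_sin_rev.
have L1g2 : L1on 0 1 g2 by exact: L1on_glue.
have L1g2x : L1on 0 x g2 by exact: L1on_sub L1g2.
have L1s : L1on 0 x (fun t => sin (s * (x - t)) ^+ 2) by apply: L1on_sq; exact: continuous_sin_rev.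
apply: (@le_trans _ _ (int 0 x (fun t => (2 * s)^-1 * (sin (s * (x - t)) ^+ 2 + g2 t)))).
  apply: int_norm_le.
  - apply: L1onM; first exact: continuous_sin_rev.
    have L : L1on 0 1 (glue (1 / 2) u10 u20) by apply: L1on_glue => //; exact: L1on_continuous.
    exact: L1on_sub L.
  - by apply: L1onZ; exact: L1onD.
  move=> t _; rewrite g2E.
  have -> : glue (1 / 2) u10 u20 t = s^-1 * g t by rewrite /glue /g /glue; case: ifP => _; rewrite mulrC.
  rewrite mulrCA normrM (ger0_norm (x := s^-1)) ?invr_ge0 ?(ltW s0) //.
  rewrite [X in _ <= X](_ : _ = s^-1 * (1 / 2 * (sin (s * (x - t)) ^+ 2 + g t ^+ 2))); last by field.
  by rewrite ler_wpM2l ?invr_ge0 ?(ltW s0) // norm_mul_le_sq.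
rewrite intZ; last exact: L1onD.
rewrite intD //.
have h1 : int 0 x (fun t => sin (s * (x - t)) ^+ 2) <= 9 / 16.
  apply: (le_trans (int_sin2_le s0 x01)).
  have : (4 * s)^-1 <= 1 / 16 by rewrite invfM; move: s_inv; lra.
  by move: x1; lra.
have h2 : int 0 x g2 <= 3 / 4.
  apply: (@le_trans _ _ (int 0 1 g2)).
    rewrite [X in _ <= X](int_split x0 x1) // lerDl; apply: int_ge0 => t _.
    by rewrite g2E sqr_ge0.
  rewrite (@int_glue_right _ 0 (1 / 2) 1) //.
  have := int_sin_sq_le half01; have := int_sin_rev_sq_le 1 half_le1.
  by move: inv2s; lra.
apply: (@le_trans _ _ ((2 * s)^-1 * (9 / 16 + 3 / 4))).
  by apply: ler_wpM2l; [rewrite invr_ge0 mulr_ge0 // ltW|exact: lerD].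
by rewrite le_eqVlt; apply/orP; left; apply/eqP; field.
Qed.

End CaseA.

Section CaseB.
(** [e] stands for [(-1) ^ n + 1], the amplitude on the right half relative to the left one. *)
Context (e : R).
Hypothesis e_ge0 : 0 <= e.
Hypothesis sin_s : sin s = 0.
Hypothesis cos_s : cos s = 1.

Let u10 x := sin (s * x) / s.
Let u20 x := e / s * sin (s * x).

Let cu10 : continuous u10.
Proof. by move=> t; apply: cvgMr_tmp; exact: continuous_sin_mul. Qed.

Let cu20 : continuous u20.
Proof. by move=> t; apply: cvgMl_tmp; exact: continuous_sin_mul. Qed.

(** The two halves contribute [- 1 / (4 s)] and [- e / (4 s)]; as [e >= 0] they cannot cancel. *)
Lemma solvability_b :
  `|int 0 1 (fun t => sin (s * (1 - t)) * glue (1 / 2) u10 u20 t)| = (1 + e) / (4 * s).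
Proof.
rewrite int_mul_glue ?ler01 ?lexx //; last exact: continuous_sin_rev.
rewrite leNgt (_ : 1 / 2 < 1) /=; last by lra.
have L1ss c d : L1on c d (fun t => sin (s - s * t) * sin (0 + s * t)).
  apply: L1onM; first exact: continuous_sin_shift.
  by apply: L1on_continuous; exact: continuous_sin_affine.
have -> : int 0 (1 / 2) (fun t => sin (s * (1 - t)) * u10 t) =
    s^-1 * int 0 (1 / 2) (fun t => sin (s - s * t) * sin (0 + s * t)).
  rewrite -intZ //.
  by apply: int_ext => t _; rewrite /u10 add0r mulrBr mulr1; ring.
have -> : int (1 / 2) 1 (fun t => sin (s * (1 - t)) * u20 t) =
    (e / s) * int (1 / 2) 1 (fun t => sin (s - s * t) * sin (0 + s * t)).
  rewrite -intZ //.
  by apply: int_ext => t _; rewrite /u20 add0r mulrBr mulr1; ring.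
rewrite !int_sin_sin // addr0 cos_s.
rewrite (_ : s - 0 - 2 * s * 0 = s); last by ring.
rewrite (_ : s - 0 - 2 * s * (1 / 2) = 0); last by field.
rewrite (_ : s - 0 - 2 * s * 1 = - s); last by ring.
rewrite sin0 sinN sin_s [X in `|X|](_ : _ = - ((1 + e) / (4 * s))); last by field.
by rewrite normrN ger0_norm // divr_ge0 ?addr_ge0 // mulr_ge0 // ltW.
Qed.

(** AM-GM on an interval of length at most 1/2: each squared sine integrates to at most
    [1 / 4 + 1 / (2 s) <= 3 / 8]. *)
Lemma response_half x c d : 0 <= c -> c <= d -> d - c <= 1 / 2 ->
  `|int c d (fun t => sin (s * (x - t)) * sin (s * t))| <= 3 / 8.
Proof.
move=> c0 cd dc.
have cs1 := continuous_sin_mul.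
have cs2 : continuous (fun t => sin (s * (x - t))) by exact: continuous_sin_rev.
apply: (@le_trans _ _ (int c d (fun t => 1 / 2 * (sin (s * (x - t)) ^+ 2 + sin (s * t) ^+ 2)))).
  apply: int_norm_le => [||t _]; last exact: norm_mul_le_sq.
    by apply: L1onM => //; exact: L1on_continuous.
  by apply: L1onZ; apply: L1onD; exact: L1on_sq.
rewrite intZ; last by apply: L1onD; exact: L1on_sq.
rewrite intD; [|exact: L1on_sq|exact: L1on_sq].
have := int_sin_sq_le cd; have := int_sin_rev_sq_le x cd.
by move: inv2s dc; lra.
Qed.

Lemma response_b x : 0 <= x <= 1 ->
  `|int 0 x (fun t => sin (s * (x - t)) * glue (1 / 2) u10 u20 t)| <= 3 / 8 * (1 + e) / s.
Proof.
move=> x01; have [x0 x1] := andP x01.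
rewrite int_mul_glue //; last exact: continuous_sin_rev.
have cs1 := continuous_sin_mul.
have L1ss c d : L1on c d (fun t => sin (s * (x - t)) * sin (s * t)).
  by apply: L1onM; [exact: continuous_sin_rev|exact: L1on_continuous].
have E1 d : int 0 d (fun t => sin (s * (x - t)) * u10 t) =
    s^-1 * int 0 d (fun t => sin (s * (x - t)) * sin (s * t)).
  by rewrite -intZ //; apply: int_ext => t _; rewrite /u10; ring.
have E2 : int (1 / 2) x (fun t => sin (s * (x - t)) * u20 t) =
    (e / s) * int (1 / 2) x (fun t => sin (s * (x - t)) * sin (s * t)).
  by rewrite -intZ //; apply: int_ext => t _; rewrite /u20; ring.
have sinv0 : 0 <= s^-1 by rewrite invr_ge0 ltW.
have -> : 3 / 8 * (1 + e) / s = s^-1 * (3 / 8) + e / s * (3 / 8) by field.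
have es0 : 0 <= e / s by rewrite mulr_ge0.
case: (leP x (1 / 2)) => xh.
  rewrite E1 normrM (ger0_norm sinv0) ler_wpDr //; first by rewrite mulr_ge0.
  by rewrite ler_wpM2l // response_half // subr0.
rewrite E1 E2; apply: (le_trans (ler_normD _ _)); apply: lerD.
  by rewrite normrM (ger0_norm sinv0) ler_wpM2l // response_half // subr0.
rewrite normrM (ger0_norm es0) ler_wpM2l // response_half //; first exact: ltW.
by move: x1; lra.
Qed.

End CaseB.
End TrialFunctions.

(** * Derivatives, frequencies and rates of the trial pairs *)

Section Instances.
Context {R : realType}.

Lemma is_derive_sin_rev (s x : R) :
  is_derive x 1 (fun t => sin (s * (1 - t))) (- (s * cos (s * (1 - x)))).
Proof.
rewrite (_ : (fun t => _) = (fun t => sin (s + (- s) * t))).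
  by apply: (is_derive_eq (is_derive_sin_affine s (- s) x)); rewrite mulNr mulrBr mulr1 mulNr.
by apply/funext => t; congr sin; ring.
Qed.

Lemma is_derive_cos_rev (s x : R) :
  is_derive x 1 (fun t => cos (s * (1 - t))) (s * sin (s * (1 - x))).
Proof.
rewrite (_ : (fun t => _) = (fun t => cos (s + (- s) * t))).
  apply: (is_derive_eq (is_derive_cos_affine s (- s) x)).
  by rewrite mulNr opprK mulrBr mulr1 mulNr.
by apply/funext => t; congr cos; ring.
Qed.

Lemma is_derive_sin_mul (s x : R) :
  is_derive x 1 (fun t => sin (s * t)) (s * cos (s * x)).
Proof.
rewrite (_ : (fun t => _) = (fun t => sin (0 + s * t))).
  by apply: (is_derive_eq (is_derive_sin_affine 0 s x)); rewrite add0r.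
by apply/funext => t; rewrite add0r.
Qed.

Lemma is_derive_cos_mul (s x : R) :
  is_derive x 1 (fun t => cos (s * t)) (- (s * sin (s * x))).
Proof.
rewrite (_ : (fun t => _) = (fun t => cos (0 + s * t))).
  by apply: (is_derive_eq (is_derive_cos_affine 0 s x)); rewrite add0r.
by apply/funext => t; rewrite add0r.
Qed.

Lemma is_derive_mulr (f : R -> R) (A df x : R) :
  is_derive x 1 f df -> is_derive x 1 (fun t => A * f t) (A * df).
Proof. by move=> h; exact: (is_deriveZ A h). Qed.

(** The bound [s >= 4] used throughout comes from [2 pi |x|] with [pi >= 3] and [|x| >= 2 / 3]. For
    [n = 0] and the minus sign [x] is negative; evenness of the cosine covers this. *)
Lemma sqrt_trial (b : bool) (n : nat) (x := (if b then 1 else -1) * (2 / 3) + 2 * n%:R : R)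
    (sq := Num.sqrt (4 * pi ^+ 2 * x ^+ 2)) :
  [/\ 4 <= sq, sq ^+ 2 = 4 * pi ^+ 2 * x ^+ 2 & cos (sq / 2) = - (1 / 2)].
Proof.
have p3 := @pi_ge3 R.
have sqE : sq = 2 * pi * `|x|.
  rewrite /sq (_ : 4 * pi ^+ 2 * x ^+ 2 = (2 * pi * x) ^+ 2); last by ring.
  by rewrite sqrtr_sqr normrM ger0_norm // mulr_ge0 // pi_ge0.
have x23 : 2 / 3 <= `|x|.
  rewrite /x; case: b {sq sqE} @x => x.
    by apply: le_trans (ler_norm _); have : 0 <= n%:R :> R by []; lra.
  case: n @x => [|n] x.
    by rewrite mulr0 addr0 mulN1r normrN ger0_norm //; lra.
  by apply: le_trans (ler_norm _); rewrite -natr1; have : 0 <= n%:R :> R by []; lra.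
split.
- rewrite sqE; apply: (@le_trans _ _ (2 * 3 * (2 / 3))); first lra.
  by apply: ler_pM => //; lra.
- by rewrite sqr_sqrtr //; apply: mulr_ge0; [apply: mulr_ge0|]; rewrite ?sqr_ge0.
have -> : sq / 2 = pi * `|x| by rewrite sqE; move: (pi : R) => p; field.
have cosnorm : cos (pi * `|x|) = cos (pi * x).
  by case: (ger0P x) => _ //; rewrite mulrN cosN.
rewrite cosnorm /x.
have c2n (y : R) : cos (y + 2 * n%:R * pi) = cos y.
  have e : 2 * n%:R * pi = (2 * n)%N%:R * pi :> R by rewrite natrM.
  by rewrite cosD e cos_natmul_pi sin_natmul_pi mulr0 subr0 mulnC exprM sqrr_sign mulr1.
case: b {sq sqE cosnorm x23} @x => x.
  rewrite (_ : pi * _ = 2 * pi / 3 + 2 * n%:R * pi); last by move: (pi : R) => p; field.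
  by rewrite c2n cos_2pi_div3.
rewrite (_ : pi * _ = - (2 * pi / 3) + 2 * n%:R * pi); last by move: (pi : R) => p; field.
by rewrite c2n cosN cos_2pi_div3.
Qed.

(** After multiplication by [s] the left side is [99 / 128], about 0.773; on the right
    [sqrt 3 <= 7 / 4] gives at least [3 / 8 * (99 / 100) ^ 2 * (15 / 7)], about 0.788. *)
Lemma rate_a_ge (s : R) : 4 <= s ->
  let K := (2 + Num.sqrt 3) / (Num.sqrt 3 * s) in
  0 < K /\ 3 / 4 * (21 / (32 * s) + 3 / (8 * s)) <= s * (3 / (8 * s)) * ((99 / 100) ^+ 2 * K).
Proof.
move=> s4 K; have s0 : 0 < s by apply: lt_le_trans s4.
set r := Num.sqrt 3 in K *.
have r0 : 0 < r by rewrite sqrtr_gt0.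
have r74 : r <= 7 / 4.
  rewrite -(@ler_pXn2r _ 2) ?nnegrE ?(ltW r0) // sqr_sqrtr //.
  by rewrite expr2; lra.
have K0 : 0 < K by rewrite divr_gt0 ?addr_gt0 ?mulr_gt0.
split => //.
have rinv : 4 / 7 <= r^-1 by rewrite -[r^-1]mul1r ler_pdivlMr //; lra.
have -> : s * (3 / (8 * s)) * ((99 / 100) ^+ 2 * K) =
    s^-1 * (3 / 8 * (99 / 100) ^+ 2 * (1 + 2 * r^-1)) by rewrite /K; field; rewrite !gt_eqF.
have -> : 3 / 4 * (21 / (32 * s) + 3 / (8 * s)) = s^-1 * (99 / 128) by field; rewrite gt_eqF.
by rewrite ler_pM2l ?invr_gt0 // expr2; lra.
Qed.

Lemma norm_sin_le1 (x : R) : `|sin x| <= 1.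
Proof. by rewrite ler_norml sin_geN1 sin_le1. Qed.

End Instances.

Unset Implicit Arguments.

Theorem theorem2 (R : realType) (q : R -> R) (a : nat -> R) (N Nbar : R -> R)
  (v : nat -> R) :
  L1on 0 1 q ->
  (forall u : R, (fun n => \sum_(i < n) a i.+1 * u ^+ i.+1) @ \oo --> N u) ->
  (forall (k : nat) (x : R), derivable (derive1n k Nbar) x 1) ->
  (forall (k : nat) (u : R), `|derive1n k N u| <= derive1n k Nbar `|u|) ->
  majorant (\int[@lebesgue_measure R]_(x in `[0, 1]%classic) `|q x|) Nbar v ->
  (* part (a) *)
  (forall (s : bool) (n : nat),
    let lam0 : R := 4 * pi ^+ 2 * ((if s then 1 else -1) * (2 / 3) + 2 * n%:R) ^+ 2 in
    let sq : R := Num.sqrt lam0 in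
    let K : R := (2 + Num.sqrt 3) / (Num.sqrt 3 * sq) in
    (K%:E < conv_radius v)%E ->
    let rn : R := K * invR (conv_radius v) in
    forall (lam : nat -> R) (u1 u2 du1 du2 : nat -> R -> R),
      FD_seq q N lam0 (fun x => sin (sq * x) / sq) (fun x => sin (sq * (1 - x)) / sq)
        lam u1 u2 du1 du2 ->
      FD_conclusion q N rn lam u1 u2
        (fun C eps m => C / (powR (m.+1)%:R (1 + eps)) * invR (conv_radius v) * rn ^+ m)
        (fun C eps m => 3 * C / (8 * powR (m.+1)%:R (1 + eps) * sq) * rn ^+ m.+1)) /\
  (* part (b) *)
  (forall n : nat, (0 < n)%N ->
    let lam0 : R := 4 * pi ^+ 2 * n%:R ^+ 2 in
    let K : R := 1 / (pi * n%:R) in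
    (K%:E < conv_radius v)%E ->
    let rn : R := K * invR (conv_radius v) in
    forall (lam : nat -> R) (u1 u2 du1 du2 : nat -> R -> R),
      FD_seq q N lam0 (fun x => sin (2 * pi * n%:R * x) / (2 * pi * n%:R))
        (fun x => ((-1) ^+ n + 1) / (2 * pi * n%:R) * sin (2 * pi * n%:R * x))
        lam u1 u2 du1 du2 ->
      FD_conclusion q N rn lam u1 u2
        (fun C eps m => C / (powR (m.+1)%:R (1 + eps)) * invR (conv_radius v) * rn ^+ m)
        (fun C eps m => (if odd n then 1 else 3) * C
                        / (8 * pi * n%:R * powR (m.+1)%:R (1 + eps)) * rn ^+ m.+1)).
Proof.
(* Origin of [99 / 100]: the rate conditions ask for [om ^ 2 >= 77 / 80] in (a), with [7 / 4] in
   place of [sqrt 3], and for [om ^ 2 >= 15 / 16] in (b). *)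
move=> L1q hN dNbar N_le maj; have om01 : 0 < (99 / 100 : R) < 1 by apply/andP; split; lra.
split.
  move=> b n lam0 sq K KR rn lam u1 u2 du1 du2 hFD.
  have [s4 sqE cosh] := @sqrt_trial R b n.
  rewrite -/lam0 -/sq in s4 sqE cosh.
  have s0 : 0 < sq by apply: lt_le_trans s4.
  have sn0 : sq != 0 by rewrite gt_eqF.
  have [K0 hK] := rate_a_ge s4.
  have sinv : sq^-1 <= 1 / 4 by rewrite -[sq^-1]mul1r ler_pdivrMr //; lra.
  have sinv0 : 0 < sq^-1 by rewrite invr_gt0.
  apply: (@FD_method_converges _ q a N Nbar v sq (3 / (8 * sq)) (21 / (32 * sq)) (99 / 100) K
    (fun x => sin (sq * x) / sq) (fun x => sin (sq * (1 - x)) / sq)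
    (fun x => cos (sq * x)) (fun x => - cos (sq * (1 - x))) lam u1 u2 du1 du2) => //.
  - by rewrite invfM mulrA; lra.
  - by rewrite invfM mulrA; lra.
  - move=> x; rewrite (_ : (fun t => _) = (fun t => sq^-1 * sin (sq * t))); last first.
      by apply/funext => t; rewrite mulrC.
    by apply: (is_derive_eq (is_derive_mulr sq^-1 (is_derive_sin_mul sq x))); rewrite mulKf.
  - move=> x; apply: (is_derive_eq (is_derive_cos_mul sq x)); field; exact: sn0.
  - move=> x; rewrite (_ : (fun t => _) = (fun t => sq^-1 * sin (sq * (1 - t)))); last first.
      by apply/funext => t; rewrite mulrC.
    apply: (is_derive_eq (is_derive_mulr sq^-1 (is_derive_sin_rev sq x))).
    by rewrite mulrN mulKf.
  - move=> x; rewrite (_ : (fun t => _) = (fun t => -1 * cos (sq * (1 - t)))); last first.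
      by apply/funext => t; rewrite mulN1r.
    by apply: (is_derive_eq (is_derive_mulr (-1) (is_derive_cos_rev sq x))); field.
  - by rewrite mulr0 sin0 mul0r.
  - by rewrite subrr mulr0 sin0 mul0r.
  - by rewrite mulr0 cos0.
  - by congr (sin (_ * _) / _); lra.
  - rewrite (_ : 1 - 1 / 2 = 2^-1); last by lra.
    by rewrite (_ : 1 / 2 = 2^-1 :> R) ?mul1r // cosh; lra.
  - move=> x _; apply: (@le_trans _ _ sq^-1).
      by rewrite /glue; case: ifP => _; rewrite normrM (ger0_norm (ltW sinv0)) ler_piMl ?norm_sin_le1 // ltW.
    by rewrite invfM mulrA; lra.
  - exact: solvability_a.
  - exact: response_a.
  - by rewrite sqE.
  - move=> C eps m; have p0 : powR (m.+1)%:R (1 + eps) != 0 :> R by rewrite gt_eqF // powR_gt0.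
    by rewrite -/rn; field; apply/andP.
move=> n n0 lam0 K KR rn lam u1 u2 du1 du2 hFD.
set s := 2 * pi * n%:R in hFD.
have n1 : 1 <= n%:R :> R by rewrite ler1n.
have p3 := @pi_ge3 R.
have s4 : 4 <= s.
  apply: (@le_trans _ _ (2 * 3 * 1)); first lra.
  by apply: ler_pM => //; apply: ler_pM => //; lra.
have s0 : 0 < s by apply: lt_le_trans s4.
have sn0 : s != 0 by rewrite gt_eqF.
have sinv0 : 0 < s^-1 by rewrite invr_gt0.
have sinv : s^-1 <= 1 / 4 by rewrite -[s^-1]mul1r ler_pdivrMr //; lra.
have KE : K = 2 / s.
  by rewrite /K /s -mulrA [(2 * _)^-1]invfM mulVKf // div1r.
set eps := (-1) ^+ n in hFD.
have eps2 : eps * eps = 1 :> R by rewrite /eps -expr2 sqrr_sign.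
have ss : s = (2 * n)%N%:R * pi by rewrite /s natrM mulrAC.
have sh : s * (1 / 2) = n%:R * pi by rewrite /s; move: (pi : R) => p; field.
have sins : sin s = 0 by rewrite ss sin_natmul_pi.
have coss : cos s = 1 by rewrite ss cos_natmul_pi mulnC exprM sqrr_sign.
have sinh : sin (s * (1 / 2)) = 0 by rewrite sh sin_natmul_pi.
have cosh : cos (s * (1 / 2)) = eps by rewrite sh cos_natmul_pi.
have epsE : eps = if odd n then -1 else 1 by rewrite /eps -signr_odd; case: odd; rewrite ?expr1 ?expr0.
have e0 : 0 <= eps + 1 by rewrite epsE; case: odd; lra.
have e2 : eps + 1 <= 2 by rewrite epsE; case: odd; lra.
apply: (@FD_method_converges _ q a N Nbar v s ((1 + (eps + 1)) / (4 * s))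
    (3 / 8 * (1 + (eps + 1)) / s) (99 / 100) K
    (fun x => sin (s * x) / s) (fun x => (eps + 1) / s * sin (s * x))
    (fun x => cos (s * x)) (fun x => (eps + 1) * cos (s * x)) lam u1 u2 du1 du2) => //.
- by rewrite divr_gt0 ?mulr_gt0 //; lra.
- rewrite invfM mulrA -[_ / 4 / s]mulrA; apply: (@le_trans _ _ (3 * (4^-1 * (1 / 4)))); last by lra.
  by apply: ler_pM => //; [lra|rewrite mulr_ge0 // ltW|lra|apply: ler_pM => //; rewrite ltW].
- by rewrite KE divr_gt0.
- rewrite KE.
  have -> : 3 / 4 * (3 / 8 * (1 + (eps + 1)) / s + (1 + (eps + 1)) / (4 * s)) =
     (1 + (eps + 1)) / s * (15 / 32) by field.
  have -> : s * ((1 + (eps + 1)) / (4 * s)) * ((99 / 100) ^+ 2 * (2 / s)) =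
     (1 + (eps + 1)) / s * ((99 / 100) ^+ 2 / 2) by field.
  by apply: ler_wpM2l; [rewrite divr_ge0 ?(ltW s0) //; lra|rewrite expr2; lra].
- move=> x; rewrite (_ : (fun t => _) = (fun t => s^-1 * sin (s * t))); last first.
    by apply/funext => t; rewrite mulrC.
  by apply: (is_derive_eq (is_derive_mulr s^-1 (is_derive_sin_mul s x))); rewrite mulKf.
- move=> x; apply: (is_derive_eq (is_derive_cos_mul s x)); field; exact: sn0.
- move=> x; apply: (is_derive_eq (is_derive_mulr ((eps + 1) / s) (is_derive_sin_mul s x))).
  by field; exact: sn0.
- move=> x; apply: (is_derive_eq (is_derive_mulr (eps + 1) (is_derive_cos_mul s x))).
  by field; exact: sn0.
- by rewrite mulr0 sin0 mul0r.
- by rewrite mulr1 sins mulr0.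
- by rewrite mulr0 cos0.
- by rewrite sinh mulr0 mul0r.
- by rewrite cosh mulrDl eps2 mul1r addrK.
(* [4 * kap = (1 + (eps + 1)) / s] dominates both amplitudes [1 / s] and [(eps + 1) / s]; for odd
   [n] it is exactly the amplitude [1 / s]. *)
- move=> x _; apply: (@le_trans _ _ ((1 + (eps + 1)) / s)); last first.
    by rewrite le_eqVlt; apply/orP; left; apply/eqP; field.
  rewrite /glue; case: ifP => _; rewrite normrM.
    rewrite (ger0_norm (ltW sinv0)) ler_wpM2r ?(ltW sinv0) //.
    by apply: (le_trans (norm_sin_le1 _)); lra.
  rewrite ger0_norm ?divr_ge0 ?(ltW s0) // -[X in _ <= X]mulr1.
  apply: ler_pM => //; [by rewrite divr_ge0 ?(ltW s0)| |exact: norm_sin_le1].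
  by rewrite ler_wpM2r ?(ltW sinv0) //; lra.
- exact: solvability_b.
- exact: response_b.
- by rewrite (_ : s ^+ 2 = lam0) // /s /lam0 !exprMn; congr (_ * _ * _); rewrite expr2; ring.
- move=> C d m; have p0 : powR (m.+1)%:R (1 + d) != 0 :> R by rewrite gt_eqF // powR_gt0.
  rewrite -/rn (_ : (if odd n then 1 else 3) = 1 + (eps + 1)); last by rewrite epsE; case: odd; lra.
  rewrite (_ : 8 * pi * n%:R = 4 * s); last by rewrite /s; move: (pi : R) => p; ring.
  by field; apply/andP.
Qed.
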